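(* Let $\mu,\nu\in\mathcal{P}_{ex}(\mathbb{R}^{\infty})$ satisfy $\int x_1^2\,d\mu+\int y_1^2\,d\nu<\infty$. For each $n\ge 1$ let $\mu_n,\nu_n$ be the images of $\mu,\nu$ under the projection onto the first $n$ coordinates, regarded as measures on $\mathbb{R}^n$, and let $T_n=\nabla\Phi_n$, with $\Phi_n:\mathbb{R}^n\to\mathbb{R}$ convex and differentiable, be the optimal transportation mapping pushing $\mu_n$ forward onto $\nu_n$ for the cost function $\sum_{i=1}^n(x_i-y_i)^2$. Assume that there exists $K>0$ such that $$\Phi_n(a)-\Phi_n(b)-\langle\nabla\Phi_n(b),a-b\rangle\le K\|a-b\|^2$$ for all $n\ge 1$ and all $a,b\in\mathbb{R}^n$. Then there exists a solution to the exchangeable Monge problem for $(\mu,\nu)$, i.e. there exists a Borel exchangeable mapping $T:\mathbb{R}^{\infty}\to\mathbb{R}^{\infty}$ such that the measure $\pi=\mu\circ(x,T(x))^{-1}$ is a solution to the exchangeable Kantorovich problem for $(\mu,\nu)$.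
   Context: $\mathbb{R}^{\infty}$ is the Polish space of real sequences $x=(x_1,x_2,\ldots)$ with the product topology and its Borel $\sigma$-algebra. $\mathcal{S}_{\infty}$ is the group of all linear maps $g$ of $\mathbb{R}^{\infty}$ of the form $g(x_1,\ldots,x_n,x_{n+1},\ldots)=(x_{\sigma(1)},\ldots,x_{\sigma(n)},x_{n+1},\ldots)$ for some $n$ and some permutation $\sigma\in S_n$. A Borel probability measure on $\mathbb{R}^{\infty}$ is exchangeable if it is invariant under every $g\in\mathcal{S}_{\infty}$; $\mathcal{P}_{ex}(\mathbb{R}^{\infty})$ is the set of such measures. A measure on $\mathbb{R}^{\infty}\times\mathbb{R}^{\infty}$ is exchangeable if it is invariant under $(x,y)\mapsto(g(x),g(y))$ for every $g\in\mathcal{S}_{\infty}$. A map $T:\mathbb{R}^{\infty}\to\mathbb{R}^{\infty}$ is exchangeable if $T\circ g=g\circ T$ for every $g\in\mathcal{S}_{\infty}$. Exchangeable Kantorovich problem for $(\mu,\nu)$: minimize $\pi\mapsto\int (x_1-y_1)^2\,d\pi$ over all exchangeable probability measures $\pi$ on $\mathbb{R}^{\infty}\times\mathbb{R}^{\infty}$ with marginals $\mu,\nu$. The measure $\mu\circ(x,T(x))^{-1}$ is the image of $\mu$ under $x\mapsto(x,T(x))$. $\|\cdot\|$ and $\langle\cdot,\cdot\rangle$ are the Euclidean norm and inner product on $\mathbb{R}^n$. $T_n$ being the optimal transportation mapping means that the image of $\mu_n$ under $x\mapsto(x,T_n(x))$ has marginals $\mu_n,\nu_n$ and minimizes $\int\sum_{i=1}^n(x_i-y_i)^2\,d\theta$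 over all couplings $\theta$ of $\mu_n$ and $\nu_n$. *)

(* Defs.v *)
From HB Require Import structures.
From mathcomp Require Import all_boot all_order all_algebra all_fingroup.
From mathcomp Require Import all_classical all_reals all_analysis.

Set Implicit Arguments.
Unset Strict Implicit.
Unset Printing Implicit Defensive.

Import Order.TTheory GRing.Theory Num.Theory.
Import numFieldNormedType.Exports.

Local Open Scope classical_set_scope.
Local Open Scope ring_scope.

Notation borel T := (g_sigma_algebraType (@open T)).

(* Sequences are indexed from 0: the coordinate x_(i+1) is [x i]. *)
Notation Rinfty R := {ptws nat -> (R : realType)}.

Section permutations.
Variable R : realType.

(* g(x_1, ..., x_n, x_(n+1), ...) = (x_(s 1), ..., x_(s n), x_(n+1), ...) *)
Definition perm_coord n (s : 'S_n) (x : borel (Rinfty R)) : borel (Rinfty R) :=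
  fun i => if insub i is Some j then x (s j) else x i.

Definition exchangeable (mu : probability (borel (Rinfty R)) R) : Prop :=
  forall n (s : 'S_n) A, measurable A -> pushforward mu (perm_coord s) A = mu A.

(* The product sigma-algebra is the Borel one: the factors are second countable. *)
Definition exchangeable2
    (pi : probability (borel (Rinfty R) * borel (Rinfty R))%type R) : Prop :=
  forall n (s : 'S_n) A, measurable A ->
    pushforward pi (fun z => (perm_coord s z.1, perm_coord s z.2)) A = pi A.

Definition exchangeable_map (T : borel (Rinfty R) -> borel (Rinfty R)) : Prop :=
  forall n (s : 'S_n), T \o perm_coord s = perm_coord s \o T.

End permutations.

Section transport.
Local Open Scope ereal_scope.
Context d1 d2 (X : measurableType d1) (Y : measurableType d2) (R : realType).

Definition coupling (mu : probability X R) (nu : probability Y R)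
    (pi : probability (X * Y)%type R) : Prop :=
  (forall A, measurable A -> pushforward pi fst A = mu A) /\
  (forall B, measurable B -> pushforward pi snd B = nu B).

Definition minimizes (c : X * Y -> R) (P : probability (X * Y)%type R -> Prop)
    (pi : probability (X * Y)%type R) : Prop :=
  P pi /\
  forall theta : probability (X * Y)%type R, P theta ->
    \int[pi]_z (c z)%:E <= \int[theta]_z (c z)%:E.

Definition graph (T : X -> Y) (x : X) : X * Y := (x, T x).

Lemma measurable_graph (T : {mfun X >-> Y}) : measurable_fun setT (graph T).
Proof. exact/measurable_fun_pair. Qed.

HB.instance Definition _ (T : {mfun X >-> Y}) :=
  isMeasurableFun.Build _ _ _ _ (graph T) (measurable_graph T).

End transport.

Section exchangeable_kantorovich.
Variable R : realType.

Definition exchangeable_kantorovich_solution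
    (mu nu : probability (borel (Rinfty R)) R)
    (pi : probability (borel (Rinfty R) * borel (Rinfty R))%type R) : Prop :=
  minimizes (fun z : borel (Rinfty R) * borel (Rinfty R) => (z.1 0%N - z.2 0%N) ^+ 2)
    (fun theta => coupling mu nu theta /\ exchangeable2 theta) pi.

End exchangeable_kantorovich.

Section finite_dimensional.
Variables (R : realType) (n : nat).

Definition proj_coord (x : borel (Rinfty R)) : borel 'rV[R]_n :=
  \row_(i < n) x i.

Lemma continuous_proj_coord :
  continuous (proj_coord : Rinfty R -> 'rV[R]_n).
Proof.
move=> x A [P nP sPA].
have nQ : nbhs (x : Rinfty R) [set y : Rinfty R | forall i : 'I_n, P ord0 i (y i)].
  apply: (@filter_forall (Rinfty R) _ (fun (i : 'I_n) y => P ord0 i (y i)) (nbhs (x : Rinfty R))).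
  move=> i; apply: (@proj_continuous nat (fun=> R) i x).
  by have := nP ord0 i; rewrite mxE.
apply: filterS nQ => y yP; apply: sPA => i j.
by rewrite mxE (ord1 i); exact: yP.
Qed.

Lemma measurable_proj_coord : measurable_fun setT proj_coord.
Proof.
apply: (@measurability _ _ _ (borel 'rV[R]_n) setT proj_coord open) => //.
move=> _ [B oB <-]; rewrite setTI; apply: sub_sigma_algebra.
by move: continuous_proj_coord => /continuousP; exact.
Qed.

HB.instance Definition _ :=
  isMeasurableFun.Build _ _ _ _ proj_coord measurable_proj_coord.

(* The normed structure of the library on ['rV[R]_n] is the sup norm. *)
Definition dot (u v : 'rV[R]_n) : R := \sum_(i < n) u ord0 i * v ord0 i.

Definition enorm (u : 'rV[R]_n) : R := Num.sqrt (dot u u).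

Definition gradient (f : 'rV[R]_n -> R) (x : 'rV[R]_n) : 'rV[R]_n :=
  \row_(i < n) 'D_(delta_mx ord0 i) f x.

Definition optimal_map (mu nu : probability (borel 'rV[R]_n) R)
    (T : {mfun borel 'rV[R]_n >-> borel 'rV[R]_n}) : Prop :=
  minimizes (fun z : borel 'rV[R]_n * borel 'rV[R]_n =>
      \sum_(i < n) (z.1 ord0 i - z.2 ord0 i) ^+ 2)
    (coupling mu nu) (distribution mu (graph T)).

End finite_dimensional.

(* Main.v *)
(** The bound on [Phi n] makes its Legendre transform strongly convex, so for
    every coupling [(X, Y)] of the n-dimensional marginals duality gives
    [E |Y - T_n X|^2 <= 4 K E <X, T_n X - Y>].  With [Y = g^-1 (T_n (g X))] this
    shows that [T_n] commutes almost everywhere with permutations of the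
    coordinates; with [Y] the first n coordinates of [T_m], and by symmetry, it
    gives [E (T_m x - T_n x)_0^2 <= 4 K (c_n - c_m)] for [c_n = E [x_0 (T_n x)_0]].
    Hence [c_n] is nonincreasing and bounded below, and a subsequence of [T_n]
    converges almost everywhere, coordinate by coordinate.  The limit pushes [mu]
    to [nu] and is almost everywhere equivariant.  It is optimal by Fatou's lemma,
    because [E (x_0 - (T_n x)_0)^2] is 1/n times the optimal n-dimensional cost,
    which is at most the cost of any exchangeable coupling. *)

Require Import Defs.
From HB Require Import structures.
From mathcomp Require Import all_boot all_order all_algebra all_fingroup.
From mathcomp Require Import all_classical all_reals all_analysis.
From mathcomp Require Import measurable_realfun.
From mathcomp Require Import ring lra.
Import Order.TTheory GRing.Theory Num.Theory.
Import numFieldNormedType.Exports.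
Local Open Scope classical_set_scope.
Local Open Scope ring_scope.

Set Implicit Arguments.
Unset Strict Implicit.
Unset Printing Implicit Defensive.

(** * Convex functions and the Legendre transform *)

(** The duality step works because E f(X) + E f*(Y) is the same for every [Y] with the law of
    [T_n X], however [Y] is coupled to [X]. Subtracting the equality case of the Fenchel-Young
    inequality leaves only a difference of correlations. Hence the first n coordinates of [T_m] may
    compete with [T_n], although they come from another potential in another dimension. The
    resulting bound compares sums over n coordinates. Equivariance turns each sum into n equal
    terms, so n cancels; as [K] does not depend on n, the estimate for a single coordinate is
    uniform in the dimension. Equivariance must therefore be proved before convergence. Two gaps
    remain. Each [T_n] controls only n coordinates, so the law of the limit is tested on sets that
    involve finitely many coordinates. And the limit commutes with permutations only almost
    everywhere, whereas an exchangeable map must do so at every point: it is modified on a null set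
    that is itself invariant. *)

Section dot_product.
Context {R : realType} {n : nat}.
Implicit Types u v w : 'rV[R]_n.

Lemma dotC u v : dot u v = dot v u.
Proof. by apply: eq_bigr => i _; rewrite mulrC. Qed.

Lemma dotDl u v w : dot (u + v) w = dot u w + dot v w.
Proof. by rewrite -big_split; apply: eq_bigr => i _; rewrite mxE mulrDl. Qed.

Lemma dotZl (a : R) u v : dot (a *: u) v = a * dot u v.
Proof. by rewrite mulr_sumr; apply: eq_bigr => i _; rewrite mxE mulrA. Qed.

Lemma dotNl u v : dot (- u) v = - dot u v.
Proof. by rewrite -scaleN1r dotZl mulN1r. Qed.

Lemma dotBl u v w : dot (u - v) w = dot u w - dot v w.
Proof. by rewrite dotDl dotNl. Qed.

Lemma dotZr (a : R) u v : dot u (a *: v) = a * dot u v.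
Proof. by rewrite dotC dotZl dotC. Qed.

Lemma dotBr u v w : dot w (u - v) = dot w u - dot w v.
Proof. by rewrite dotC dotBl !(dotC w). Qed.

Lemma dot_ge0 u : 0 <= dot u u.
Proof. by apply: sumr_ge0 => i _; rewrite -expr2 sqr_ge0. Qed.

Lemma dot_eq0 u : dot u u = 0 -> u = 0.
Proof.
move=> /eqP; rewrite psumr_eq0 => [|i _]; last by rewrite -expr2 sqr_ge0.
move=> /allP u0; apply/rowP => i; rewrite mxE.
by have := u0 i (mem_index_enum _); rewrite mulf_eq0 orbb => /eqP.
Qed.

Lemma sqr_enorm u : enorm u ^+ 2 = dot u u.
Proof. by rewrite sqr_sqrtr// dot_ge0. Qed.

End dot_product.

Section gradient.
Context {R : realType} {n : nat}.
Variable f : 'rV[R]_n -> R.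
Hypothesis df : forall x, differentiable f x.

Lemma derive_gradient (x v : 'rV[R]_n) : 'D_v f x = dot (gradient f x) v.
Proof.
rewrite deriveE// [v in LHS]row_sum_delta linear_sum.
apply: eq_bigr => i _; rewrite linearZ/= mxE deriveE//.
by rewrite mulrC.
Qed.

(** By convexity the difference quotient from [x] towards [z] is at most [f z - f x] for steps in
    (0, 1]; the bound survives the right limit at 0. *)
Lemma gradient_convex_le (x z : 'rV[R]_n) : convex_function [set: 'rV[R]_n] f ->
  f x + dot (gradient f x) (z - x) <= f z.
Proof.
move=> cf; rewrite -derive_gradient -lerBrDl.
have dv : derivable f x (z - x) by exact: diff_derivable.
have h0 := dnbhs_filter (0 : R).
have dr := cvg_dnbhs_at_right dv.
rewrite -[leLHS](cvg_lim _ dr)//.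
apply: limr_le; first by apply/cvg_ex; eexists; exact: dr.
near=> t.
have t0 : 0 < t by [].
have t1 : t <= 1 by near: t; exact: nbhs_right_le.
rewrite /= -[_ *: _]/(_ * _) ler_pdivrMl//.
have := cf (Itv01 (ltW t0) t1) z x (in_setT _) (in_setT _).
rewrite !convRE /=.
have -> : conv (Itv01 (ltW t0) t1) (z : convex_lmodType 'rV[R]_n) x = t *: (z - x) + x.
  rewrite scalerBr -addrA (addrC (- _)); congr (_ + _).
  by rewrite /= /unstable.onem scalerBl scale1r.
rewrite /unstable.onem; lra.
Unshelve. all: by end_near.
Qed.
End gradient.

Section legendre.
Context {R : realType} {n : nat}.
Local Open Scope ereal_scope.
Variable f : 'rV[R]_n -> R.

Definition legendre (y : borel 'rV[R]_n) : \bar R :=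
  ereal_sup (range (fun x : 'rV[R]_n => (dot x y - f x)%:E)).

Lemma legendre_ge (x y : 'rV[R]_n) : (dot x y - f x)%:E <= legendre y.
Proof. by apply: ereal_sup_ubound; exists x. Qed.

Lemma continuous_dot (x : 'rV[R]_n) : continuous (fun y => dot x y).
Proof.
apply: (@continuous_big _ _ +%R) => [|i _]; first exact: add_continuous.
move=> y; apply: (@continuous_comp _ _ _ (fun v : 'rV[R]_n => v ord0 i)
  ( *%R (x ord0 i))).
  exact: coord_continuous.
exact: mulrl_continuous.
Qed.

(** A supremum of continuous functions is lower semicontinuous: its strict superlevel sets are
    unions of open sets, so the uncountable index set does no harm. *)
Lemma measurable_legendre : measurable_fun setT legendre.
Proof.
apply: (measurability _ (ErealGenOInfty.measurableE R)) => //.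
move=> _ [_ [r ->] <-]; rewrite setTI; apply: sub_sigma_algebra.
rewrite preimage_itvoy (_ : [set _ | _] =
    \bigcup_(x : 'rV[R]_n) (dot x @^-1` [set t | (r + f x < t)%R])).
  apply: bigcup_open => x _.
  apply: open_comp => [y _|]; [exact: continuous_dot|exact: open_gt].
apply/seteqP; split=> y /=.
  by move=> /ereal_sup_gt[_ [x _ <-]]; rewrite lte_fin ltrBrDr => ?; exists x.
by move=> [x _ /= rx]; apply: lt_le_trans (legendre_ge x y); rewrite lte_fin ltrBrDr.
Qed.

Hypothesis df : forall x, differentiable f x.
Hypothesis cf : convex_function [set: 'rV[R]_n] f.

Lemma legendre_gradient (x : 'rV[R]_n) :
  legendre (gradient f x) = (dot x (gradient f x) - f x)%:E.
Proof.
apply/eqP; rewrite eq_le legendre_ge andbT.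
apply: ge_ereal_sup => _ [z _ <-]; rewrite lee_fin.
have := gradient_convex_le df x z cf.
rewrite dotBr !(dotC (gradient f x)); lra.
Qed.

(** A quantitative Fenchel-Young inequality: the gap is at least quadratic in the distance from [y]
    to the gradient at [x], where equality holds. *)
Lemma legendre_ge_gradient (K : R) (x y : 'rV[R]_n) : (0 < K)%R ->
    (forall a b, f a - f b - dot (gradient f b) (a - b)
       <= K * enorm (a - b) ^+ 2)%R ->
  (dot x y - f x
    + (4 * K)^-1 * dot (y - gradient f x) (y - gradient f x))%:E <= legendre y.
Proof.
move=> K0 fK; set g := gradient f x.
(* [z] maximizes the lower bound that [fK] gives for [dot z y - f z]. *)
pose z := (x + (2 * K)^-1 *: (y - g))%R.
apply: le_trans (legendre_ge z y); rewrite lee_fin.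
have := fK z x; rewrite sqr_enorm -/g.
have -> : (z - x = (2 * K)^-1 *: (y - g))%R by rewrite /z addrC addKr.
have -> : dot z y = (dot x y + (2 * K)^-1 * dot (y - g) y)%R.
  by rewrite /z dotDl dotZl.
rewrite !dotZl !dotZr.
have -> : dot g (y - g) = (dot (y - g) y - dot (y - g) (y - g))%R.
  by rewrite -dotBr subKr dotC.
set u := dot (y - g) y; set d := dot (y - g) (y - g) => h.
(* Moving from [x] to [z] gains [(2 * K)^-1 * d] from the linear terms and loses [K] times the
   squared length of the move. *)
have -> : ((4 * K)^-1 = (2 * K)^-1 - K * ((2 * K)^-1 * (2 * K)^-1))%R by field; lra.
move: h; lra.
Qed.

End legendre.

(** * Stability of optimal maps *)

Section square_integrable.
Context d (T : measurableType d) (R : realType).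
Variable P : {measure set T -> \bar R}.
Implicit Types f g : T -> R.

Lemma Lfun2_of_sqr f : measurable_fun setT f ->
  (\int[P]_x (f x ^+ 2)%:E < +oo)%E -> f \in Lfun P 2%:E.
Proof.
move=> mf f2; rewrite inE; apply/andP; split; rewrite inE//= /finite_norm.
rewrite unlock poweR_lty//; apply: le_lt_trans f2.
by under eq_integral => x _ do rewrite /= powR_mulrn// real_normK ?num_real//.
Qed.

Lemma Lfun2B f g : f \in Lfun P 2%:E -> g \in Lfun P 2%:E ->
  (fun x => f x - g x) \in Lfun P 2%:E.
Proof.
have p1 : (1 <= 2%:E :> \bar R)%E by rewrite lee_fin; lra.
have [_ hD] := Lfun_addr_closed P p1.
by move=> fP gP; apply: (hD f (- g)) => //; exact: Lfun_oppr_closed.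
Qed.

Lemma Lfun2_mul_integrable f g : f \in Lfun P 2%:E -> g \in Lfun P 2%:E ->
  P.-integrable setT (EFin \o (fun x => f x * g x)).
Proof. by move=> fP gP; apply/Lfun1_integrable; exact: Lfun2_mul_Lfun1. Qed.

Lemma integrable_addr f g :
  P.-integrable setT (EFin \o f) -> P.-integrable setT (EFin \o g) ->
  P.-integrable setT (EFin \o (fun x => f x + g x)).
Proof. by move=> fP gP; exact: (integrableD measurableT fP gP). Qed.

Lemma integrable_subr f g :
  P.-integrable setT (EFin \o f) -> P.-integrable setT (EFin \o g) ->
  P.-integrable setT (EFin \o (fun x => f x - g x)).
Proof. by move=> fP gP; exact: (integrableB measurableT fP gP). Qed.

Lemma integrable_mulrl (k : R) f : P.-integrable setT (EFin \o f) ->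
  P.-integrable setT (EFin \o (fun x => k * f x)).
Proof. by move=> fP; exact: (integrableZl measurableT k fP). Qed.

Lemma integrable_big n (F : 'I_n -> T -> R) :
  (forall i, P.-integrable setT (EFin \o F i)) ->
  P.-integrable setT (EFin \o (fun x => \sum_(i < n) F i x)).
Proof.
move=> iF; have := integrable_sum measurableT (index_enum 'I_n)
  (fun i (_ : xpredT i) => iF i).
by apply: eq_integrable => // x _; rewrite /= -sumEFin.
Qed.

Lemma Rintegral_sum n (F : 'I_n -> T -> R) :
  (forall i, P.-integrable setT (EFin \o F i)) ->
  \int[P]_x (\sum_(i < n) F i x) = \sum_(i < n) \int[P]_x F i x.
Proof.
move=> iF; rewrite /Rintegral.
under eq_integral do rewrite -sumEFin.
rewrite (integral_sum _ (f := fun i => EFin \o F i))//.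
have fin i : (\int[P]_x (F i x)%:E)%E \is a fin_num.
  exact: (integrable_fin_num measurableT (iF i)).
by under eq_bigr => i _ do rewrite -(fineK (fin i)); rewrite sumEFin.
Qed.

Lemma integral_sum_equal n (F : 'I_n -> T -> R) (a : \bar R) :
  (forall i, measurable_fun setT (F i)) -> (forall i x, 0 <= F i x) ->
  (forall i, \int[P]_x (F i x)%:E = a)%E ->
  (\int[P]_x (\sum_(i < n) F i x)%:E = n%:R%:E * a)%E.
Proof.
move=> mF F0 Fa; under eq_integral do rewrite -sumEFin.
rewrite ge0_integral_sum//.
- by under eq_bigr do rewrite Fa; rewrite sumr_const card_ord mule_natl.
- by move=> i; exact/measurable_EFinP.
- by move=> i x _; rewrite lee_fin.
Qed.

Lemma integrable_dot n (U V : T -> 'rV[R]_n) :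
  (forall i, (fun x => U x ord0 i) \in Lfun P 2%:E) ->
  (forall i, (fun x => V x ord0 i) \in Lfun P 2%:E) ->
  P.-integrable setT (EFin \o (fun x => dot (U x) (V x))).
Proof.
move=> U2 V2.
apply: (integrable_big (F := fun i x => U x ord0 i * V x ord0 i)) => i.
exact: Lfun2_mul_integrable.
Qed.

End square_integrable.

Section equal_laws.
Context d1 d2 d3 (T : measurableType d1) (S : measurableType d2)
  (T' : measurableType d3) (R : realType).
Variables (P : {measure set T -> \bar R}) (Q : {measure set S -> \bar R}).
Variables (X : T -> T') (Y : S -> T').
Hypotheses (mX : measurable_fun setT X) (mY : measurable_fun setT Y).
Hypothesis XY : forall A, measurable A -> P (X @^-1` A) = Q (Y @^-1` A).
Local Open Scope ereal_scope.

Lemma ge0_integral_eq_law (f : T' -> \bar R) : measurable_fun setT f ->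
  (forall x, 0 <= f x) -> \int[P]_x f (X x) = \int[Q]_x f (Y x).
Proof.
move=> mf f0.
rewrite -[LHS](@ge0_integral_pushforward _ _ _ _ _ X mX P setT f)//.
rewrite -[RHS](@ge0_integral_pushforward _ _ _ _ _ Y mY Q setT f)//.
by apply: eq_measure_integral => A mA _; exact: XY.
Qed.

Lemma integrable_eq_law (f : T' -> \bar R) : measurable_fun setT f ->
  Q.-integrable setT (f \o Y) -> P.-integrable setT (f \o X).
Proof.
move=> mf /integrableP[_ fY]; apply/integrableP; split.
  exact: measurableT_comp.
have := @ge0_integral_eq_law (abse \o f) (measurableT_comp _ mf).
by move=> /= ->.
Qed.

Lemma integral_eq_law (f : T' -> \bar R) : measurable_fun setT f ->
  Q.-integrable setT (f \o Y) -> \int[P]_x f (X x) = \int[Q]_x f (Y x).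
Proof.
move=> mf fY; have fX := integrable_eq_law mf fY.
rewrite -[LHS](@integral_pushforward _ _ _ _ _ X mX P setT f)//.
rewrite -[RHS](@integral_pushforward _ _ _ _ _ Y mY Q setT f)//.
by apply: eq_measure_integral => A mA _; exact: XY.
Qed.

End equal_laws.

Section borel_functions.
Context {R : realType}.

Lemma measurable_fun_open d (T : measurableType d) (f : T -> R) :
  (forall U, open U -> measurable (f @^-1` U)) -> measurable_fun setT f.
Proof.
move=> mf; apply: (measurability _ (RGenOpens.measurableE R)) => //.
by move=> _ [_ [a [b ->]] <-]; rewrite setTI; apply: mf; exact: interval_open.
Qed.

Lemma continuous_measurable_borel {S : ptopologicalType} (f : S -> R) :
  continuous f -> measurable_fun (setT : set (borel S)) f.
Proof.
move=> cf; apply: measurable_fun_open => U oU; apply: sub_sigma_algebra.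
by apply: open_comp => // x _; exact: cf.
Qed.

Lemma continuous_borel_measurable {S S' : ptopologicalType} (f : S -> S') :
  continuous f -> measurable_fun (setT : set (borel S)) (f : borel S -> borel S').
Proof.
move=> cf; apply: (@measurability _ _ (borel S) (borel S') setT f (@open S')) => //.
move=> _ [B oB <-]; rewrite setTI; apply: sub_sigma_algebra.
by move: cf => /continuousP; exact.
Qed.

Lemma measurable_coord n (i : 'I_n) :
  measurable_fun (setT : set (borel 'rV[R]_n)) (fun u => u ord0 i : R).
Proof. by apply: continuous_measurable_borel; exact: coord_continuous. Qed.

End borel_functions.

Section stability.
Context d (Om : measurableType d) (R : realType) (P : probability Om R).
Context (n : nat) (f : 'rV[R]_n -> R) (K : R).
Variable g : borel 'rV[R]_n -> borel 'rV[R]_n.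
Hypothesis mg : measurable_fun setT g.
Hypothesis gE : forall x, g x = gradient f x.
Hypothesis df : forall x, differentiable f x.
Hypothesis cf : convex_function [set: 'rV[R]_n] f.
Hypothesis K0 : 0 < K.
Hypothesis fK : forall a b,
  f a - f b - dot (gradient f b) (a - b) <= K * enorm (a - b) ^+ 2.
Variables X Y : Om -> borel 'rV[R]_n.
Hypotheses (mX : measurable_fun setT X) (mY : measurable_fun setT Y).
Hypothesis X2 : forall i, (fun w => X w ord0 i) \in Lfun P 2%:E.
Hypothesis Y2 : forall i, (fun w => Y w ord0 i) \in Lfun P 2%:E.
Hypothesis YgX : forall A, measurable A -> P (Y @^-1` A) = P ((g \o X) @^-1` A).

Lemma gradient_Lfun2 i : (fun w => g (X w) ord0 i) \in Lfun P 2%:E.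
Proof.
have mgX : measurable_fun setT (g \o X) by exact: measurableT_comp.
apply: Lfun2_of_sqr.
  exact: (measurableT_comp (measurable_coord i)).
have <- := ge0_integral_eq_law mY mgX YgX
  (f := fun u => (u ord0 i ^+ 2)%:E).
- have := Lfun2_mul_integrable (Y2 i) (Y2 i).
  move/(integrable_lty measurableT) => /=.
  by under eq_integral do rewrite -expr2.
- apply/measurable_EFinP; apply: measurable_funX; exact: measurable_coord.
- by move=> u; rewrite lee_fin sqr_ge0.
Qed.

(** The gap [h] between [f] and its tangent at 0 lies between 0, by convexity, and [K] times the
    squared norm, by [fK]; the tangent is affine, hence integrable along [X]. *)
Lemma integrable_potential : P.-integrable setT (EFin \o (f \o X)).
Proof.
have mf : measurable_fun setT (f : borel 'rV[R]_n -> R).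
  by apply: continuous_measurable_borel => x; exact: differentiable_continuous.
have cst2 (c : R) : cst c \in Lfun P 2%:E by exact: Lfun_cst.
pose h w := f (X w) - (f 0 + dot (gradient f 0) (X w)).
have i0 : P.-integrable setT (EFin \o fun w => f 0 + dot (gradient f 0) (X w)).
  apply: integrable_addr.
    exact: finite_measure_integrable_cst.
  apply: (integrable_dot (U := fun=> gradient f 0)) => // i.
  exact: cst2.
have mfX : measurable_fun setT (f \o X) by exact: measurableT_comp.
have ih : P.-integrable setT (EFin \o h).
  apply: (@le_integrable _ _ _ _ _ measurableT _
      (EFin \o fun w => K * dot (X w) (X w))).
  - apply/measurable_EFinP/measurable_funB => //.
    by apply/measurable_EFinP; exact: (measurable_int P i0).
  - move=> w _ /=; rewrite lee_fin.
    have := gradient_convex_le df 0 (X w) cf; rewrite subr0 => h0.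
    rewrite !ger0_norm ?subr_ge0//; last by rewrite mulr_ge0 ?dot_ge0 ?ltW.
    by have := fK (X w) 0; rewrite subr0 sqr_enorm /h; lra.
  - apply: integrable_mulrl.
    exact: integrable_dot.
have := integrable_addr ih i0.
by apply: eq_integrable => // w _; rewrite /= /h subrK.
Qed.

(** Integrate [legendre_ge_gradient] at the pair [(X, Y)] and the equality [legendre_gradient] at
    [(X, g X)]. The integrals of [legendre f] agree since [Y] and [g X] have the same law, and the
    terms [f (X w)] cancel. *)
Lemma gradient_stability :
  \int[P]_w dot (Y w - g (X w)) (Y w - g (X w)) <=
  4 * K * \int[P]_w dot (X w) (g (X w) - Y w).
Proof.
have mgX : measurable_fun setT (g \o X) by exact: measurableT_comp.
have g2 := gradient_Lfun2.
have coordB i : (fun w => (Y w - g (X w)) ord0 i) \in Lfun P 2%:E.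
  rewrite (_ : (fun _ => _) = fun w => Y w ord0 i - g (X w) ord0 i).
    exact: Lfun2B.
  by apply/funext => w; rewrite !mxE.
have igX : P.-integrable setT
    (EFin \o fun w => dot (X w) (g (X w)) - f (X w)).
  apply: integrable_subr; last exact: integrable_potential.
  exact: integrable_dot.
have iL : P.-integrable setT (legendre f \o (g \o X)).
  by apply: eq_integrable igX => // w _; rewrite /= gE legendre_gradient.
(* [legendre f] may be infinite at some points; its integrability along [Y] is transferred from
   [g X], where its value is explicit. *)
have iLY := integrable_eq_law mY mgX YgX (measurable_legendre f) iL.
have idYY := integrable_dot coordB coordB.
have idXY : P.-integrable setT
    (EFin \o fun w => dot (X w) (Y w) - f (X w)).
  apply: integrable_subr; last exact: integrable_potential.
  exact: integrable_dot.
pose u w := dot (X w) (Y w) - f (X w)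
    + (4 * K)^-1 * dot (Y w - g (X w)) (Y w - g (X w)).
have idYYK : P.-integrable setT
    (EFin \o fun w => (4 * K)^-1 * dot (Y w - g (X w)) (Y w - g (X w))).
  exact: integrable_mulrl.
have iu : P.-integrable setT (EFin \o u).
  exact: integrable_addr.
have : (\int[P]_w (u w)%:E <= \int[P]_w (dot (X w) (g (X w)) - f (X w))%:E)%E.
  apply: (@le_trans _ _ (\int[P]_w (legendre f (Y w)))%E).
    apply: le_integral => // w _; rewrite /u.
    by rewrite gE; exact: legendre_ge_gradient.
  rewrite (integral_eq_law mY mgX YgX (measurable_legendre f) iL).
  rewrite le_eqVlt; apply/orP; left; apply/eqP.
  by apply: eq_integral => w _ /=; rewrite gE legendre_gradient.
move/(fine_le (integrable_fin_num measurableT iu)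
  (integrable_fin_num measurableT igX)).
rewrite -[fine _ in leLHS]/(\int[P]_w u w) -[fine _ in leRHS]/(\int[P]_w
  (dot (X w) (g (X w)) - f (X w))).
rewrite (RintegralD measurableT idXY idYYK) (RintegralZl _ measurableT idYY).
rewrite -lerBrDl -(RintegralB measurableT igX idXY).
rewrite ler_pdivrMl ?mulr_gt0// => /le_trans; apply.
rewrite le_eqVlt; apply/orP; left; apply/eqP; congr (_ * _).
by apply: eq_Rintegral => w _; rewrite dotBr; lra.
Qed.

End stability.

(** * The Borel sigma-algebra of sequences and limits of laws *)

Section borel_Rinfty.
Variable R : realType.
Notation Rinf := (borel (Rinfty R)).

Lemma measurable_eval i : measurable_fun (setT : set Rinf) (fun x => x i : R).
Proof.
apply: measurable_fun_open => U oU; apply: sub_sigma_algebra.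
by apply: open_comp => // x _; exact: (@proj_continuous nat (fun=> R) i).
Qed.

Lemma measurable_eval_comp d (T : measurableType d) (F : T -> Rinf) i :
  measurable_fun setT F -> measurable_fun setT (fun w => F w i : R).
Proof. by move=> mF; exact: (measurableT_comp (measurable_eval i) mF). Qed.

Definition rat_box (s : seq (rat * rat)) : set (Rinfty R) :=
  [set y | forall i, (i < size s)%N ->
    ratr (nth (0, 0) s i).1 < y i < ratr (nth (0, 0) s i).2].

(** Boxes with rational corners, bounding finitely many coordinates, form a base of the product
    topology. It is countable, being indexed by finite lists of pairs of rationals. *)
Lemma nbhs_rat_box (x : Rinfty R) (U : set (Rinfty R)) : nbhs x U ->
  exists2 s, rat_box s x & rat_box s `<=` U.
Proof.
move=> xU.
pose B k : set (Rinfty R) := [set y | forall i, (i < k)%N -> `|x i - y i| < k.+1%:R^-1].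
(* [F] converges to [x] in each coordinate, hence in the product topology, so every neighbourhood of
   [x] contains some [B k]. *)
pose F := filter_from [set: nat] B.
have FF : Filter F.
  apply: filter_from_filter; first by exists 0%N.
  move=> j k _ _; exists (maxn j k) => // y yB.
  have le_inv m : (m <= maxn j k)%N -> ((maxn j k).+1%:R^-1 <= m.+1%:R^-1 :> R).
    by move=> mjk; rewrite lef_pV2 ?posrE ?ltr0n// ler_nat.
  split=> i ik; (apply: lt_le_trans; [apply: yB|apply: le_inv]);
    by rewrite ?leq_maxl ?leq_maxr// (leq_trans ik)// ?leq_maxl ?leq_maxr.
have : F --> x.
  apply/(@pointwise_cvgP nat R F x) => i.
  apply/cvgrPdist_lt => e e0.
  have [k ke] : exists k : nat, k.+1%:R^-1 < e.
    by have [k _ /(_ k (leqnn k)) ] := near_infty_natSinv_lt (PosNum e0); exists k.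
  exists (maxn k i.+1) => // y /(_ i); rewrite leq_max ltnSn orbT => /(_ isT) yi.
  apply: (lt_le_trans yi); apply: (le_trans _ (ltW ke)).
  by rewrite lef_pV2 ?posrE ?ltr0n// ler_nat ltnS leq_maxl.
move=> /(_ U xU)[k _ BU].
have h i : exists q : rat * rat, x i - k.+1%:R^-1 < ratr q.1 < x i /\
    x i < ratr q.2 < x i + k.+1%:R^-1.
  have k0 : (0 : R) < k.+1%:R^-1 by rewrite invr_gt0.
  have [q] : exists q : rat, ratr q \in `]x i - k.+1%:R^-1, x i[.
    by apply: rat_in_itvoo; rewrite ltrBlDr ltrDl.
  have [r] : exists q : rat, ratr q \in `]x i, x i + k.+1%:R^-1[.
    by apply: rat_in_itvoo; rewrite ltrDl.
  by rewrite !in_itv /= => ? ?; exists (q, r).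
pose q i := sval (cid (h i)).
have qP i := svalP (cid (h i)).
exists (mkseq q k).
  move=> i; rewrite size_mkseq => ik; rewrite nth_mkseq//.
  by have [/andP[_ ->] /andP[-> _]] := qP i.
move=> y yB; apply: BU => i ik.
have := yB i; rewrite size_mkseq nth_mkseq// => /(_ ik)/andP[].
have [/andP[+ _] /andP[_ +]] := qP i.
rewrite -/(q i) ltr_distlC => a b c d'; apply/andP; split.
  exact: lt_trans c.
exact: (lt_trans d').
Qed.

Lemma open_rat_box (U : set (Rinfty R)) : open U ->
  U = \bigcup_(s in [set s | rat_box s `<=` U]) rat_box s.
Proof.
move=> oU; apply/seteqP; split=> [x Ux|x [s /= + sx]]; last exact.
have /nbhs_rat_box[s sx sU] : nbhs x U by exact: open_nbhs_nbhs.
by exists s.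
Qed.

(** An open set is a countable union of rational boxes, and the preimage of a box is a finite
    intersection of conditions on single coordinates. *)
Lemma measurable_Rinfty d (T : measurableType d) (F : T -> Rinf) :
  (forall i, measurable_fun setT (fun w => F w i : R)) -> measurable_fun setT F.
Proof.
move=> mF.
apply: (@measurability _ _ _ Rinf setT F (@open (Rinfty R))) => //.
move=> _ [U oU <-]; rewrite setTI (open_rat_box oU) preimage_bigcup bigcup_mkcond.
apply: countable_bigcupT_measurable => // s.
case: ifPn => // _.
rewrite (_ : _ @^-1` _ = \bigcap_(i in `I_(size s))
    [set w | ratr (nth (0, 0) s i).1 < F w i < ratr (nth (0, 0) s i).2]); last first.
  by apply/seteqP; split.
apply: fin_bigcap_measurable; first exact: finite_II.
move=> i _.
rewrite (_ : [set _ | _] = setT `&` (fun w => F w i) @^-1`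
    `]ratr (nth (0, 0) s i).1, ratr (nth (0, 0) s i).2[%classic).
  exact: mF.
by rewrite setTI; apply/seteqP; split=> w /=; rewrite in_itv.
Qed.

(* [a i = +oo] imposes no condition, so that half-cylinders form a pi-system. *)
Definition half_cylinder n (a : nat -> \bar R) : set Rinf :=
  [set x | forall i, (i < n)%N -> ((x i : R)%:E < a i)%E].

Definition half_cylinders : set (set Rinf) :=
  [set A | exists n a, A = half_cylinder n a].

Lemma half_cylinders_setI : setI_closed half_cylinders.
Proof.
move=> _ _ [n [a ->]] [m [b ->]].
exists (maxn n m), (fun i => Order.min (if (i < n)%N then a i else +oo%E)
                               (if (i < m)%N then b i else +oo%E)).
apply/seteqP; split=> [x [xa xb] i _|x xab].
  by rewrite lt_min; apply/andP; split; case: ifPn => [|_]; rewrite ?ltry//;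
      [exact: xa|exact: xb].
split=> i im; have := xab i; rewrite leq_max im ?orbT => /(_ isT);
  by rewrite lt_min => /andP[].
Qed.

Lemma measurable_half_cylinders : @measurable _ Rinf = <<s half_cylinders >>.
Proof.
apply/seteqP; split; last first.
  apply: smallest_sub; first exact: sigma_algebra_measurable.
  move=> _ [n [a ->]].
  rewrite (_ : half_cylinder n a = \bigcap_(i in `I_n)
      [set x | ((x i : R)%:E < a i)%E]) //.
  apply: fin_bigcap_measurable; first exact: finite_II.
  move=> i _; rewrite -[X in measurable X]setTI.
  apply: emeasurable_fun_infty_o => //.
  by apply/measurable_EFinP; exact: measurable_eval.
(* The converse inclusion says that the identity from this space to the Borel space is measurable,
   which can be checked coordinate by coordinate. *)
pose T := g_sigma_algebraType half_cylinders.
have mid : measurable_fun (setT : set T) (id : T -> Rinf).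
  apply: measurable_Rinfty => i.
  apply: (measurability _ (RGenInftyO.measurableE R)).
  move=> _ [_ [r ->] <-]; rewrite setTI; apply: sub_sigma_algebra.
  exists i.+1, (fun j => if j == i then r%:E else +oo%E).
  apply/seteqP; split=> x /=; rewrite in_itv/=.
    by move=> xr j _; case: eqP => [->|_]; rewrite ?lte_fin ?ltry.
  by move=> /(_ i (ltnSn i)); rewrite eqxx lte_fin.
by move=> A mA; have := mid measurableT A mA; rewrite setTI.
Qed.

Lemma eq_probability_half_cylinders (P Q : probability Rinf R) :
  (forall n a, P (half_cylinder n a) = Q (half_cylinder n a)) ->
  forall A, measurable A -> P A = Q A.
Proof.
move=> PQ A mA.
apply: (measure_unique half_cylinders (fun=> setT)) => //.
- exact: measurable_half_cylinders.
- exact: half_cylinders_setI.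
- by move=> _; exists 0%N, (fun=> +oo%E); apply/seteqP; split.
- by rewrite bigcup_const.
- by move=> _ [n [a ->]]; exact: PQ.
- by move=> k; rewrite (le_lt_trans (probability_le1 _ _))// ltry.
Qed.

End borel_Rinfty.

Section law_of_limit.
Context d (T : measurableType d) (R : realType) (P : probability T R).
Local Open Scope ereal_scope.

(** Fatou's lemma for sets: the tail intersections [B m] increase to a set containing [A] up to a
    null set, and each lies in every later [A_ k]. *)
Lemma measure_le_liminf (A : set T) (A_ : (set T)^nat) (c : \bar R) :
  measurable A -> (forall k, measurable (A_ k)) ->
  {ae P, forall x, A x -> \forall k \near \oo, A_ k x} ->
  (\forall k \near \oo, P (A_ k) <= c) -> P A <= c.
Proof.
move=> mA mA_ aA [N _ Nc].
pose B m := \bigcap_(k in [set k | (m <= k)%N]) A_ k.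
have mB m : measurable (B m).
  by apply: bigcap_measurable => [|k _]; [exists m => /=|exact: mA_].
have PB m : P (B m) <= c.
  apply: (@le_trans _ _ (P (A_ (maxn N m)))).
    apply: le_measure; rewrite ?inE//; apply: bigcap_inf => /=; exact: leq_maxr.
  by apply: Nc => /=; exact: leq_maxl.
have ndB : nondecreasing_seq B.
  move=> m p mp; apply/subsetPset => x xB k /= pk; apply: xB => /=.
  exact: leq_trans pk.
have mUB : measurable (\bigcup_m B m) by exact: bigcupT_measurable.
apply: (@le_trans _ _ (P (\bigcup_m B m))).
  have [Z [mZ PZ AZ]] := aA.
  apply: (@le_trans _ _ (P ((\bigcup_m B m) `|` Z))).
    apply: le_measure; rewrite ?inE//; first exact: measurableU.
    move=> x Ax; apply: contrapT => /not_orP[nBx nZx].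
    apply: nZx; apply: AZ => /= h; apply: nBx.
    by have [m _ mA'] := h Ax; exists m => // k /=; exact: mA'.
  by rewrite measureU0.
have := @nondecreasing_cvg_mu _ _ _ P _ mB mUB ndB.
move=> /cvg_lim <-//; apply: lime_le.
  by apply: ereal_nondecreasing_is_cvgn => m p mp; apply: le_measure;
    rewrite ?inE//; exact/subsetPset/ndB.
exact: nearW.
Qed.

(** A portmanteau argument on the pi-system of half-cylinders. Equality with [nu] is asked only from
    an index depending on [n], because the k-th map carries the right law on finitely many
    coordinates only. *)
Lemma law_of_limit (nu : probability (borel (Rinfty R)) R)
    (F : nat -> T -> borel (Rinfty R)) (L : T -> borel (Rinfty R)) :
  (forall k, measurable_fun setT (F k)) -> measurable_fun setT L ->
  (forall i, {ae P, forall x, (F k x i : R) @[k --> \oo] --> (L x i : R)}) ->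
  (forall n, \forall k \near \oo, forall a,
     P (F k @^-1` half_cylinder n a) = nu (half_cylinder n a)) ->
  forall A, measurable A -> P (L @^-1` A) = nu A.
Proof.
move=> mF mL cF FE.
have mH n a : measurable (half_cylinder n a : set (borel (Rinfty R))).
  rewrite measurable_half_cylinders; apply: sub_sigma_algebra.
  by exists n, a.
have mpre (G : T -> borel (Rinfty R)) n a : measurable_fun setT G ->
    measurable (G @^-1` half_cylinder n a).
  by move=> mG; rewrite -[X in measurable X]setTI; exact: mG.
pose L' : {mfun T >-> borel (Rinfty R)} := HB.pack L (isMeasurableFun.Build _ _ _ _ L mL).
suff PL n a : P (L @^-1` half_cylinder n a) = nu (half_cylinder n a).
  exact: (@eq_probability_half_cylinders _ (distribution P L')).
have acF : {ae P, forall x, forall i, (F k x i : R) @[k --> \oo] --> (L x i : R)}.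
  by apply/ae_foralln => i; exact: cF.
apply/eqP; rewrite eq_le; apply/andP; split.
  apply: (@measure_le_liminf _ (fun k => F k @^-1` half_cylinder n a)).
  - exact: mpre.
  - by move=> k; exact: mpre.
  - apply: filterS acF => x cx Lx.
    suff : \forall k \near \oo, forall i : 'I_n, (F k x i)%:E < a i.
      by apply: filterS => k h i im; exact: (h (Ordinal im)).
    apply: filter_forall => i.
    have := Lx i (ltn_ord i).
    case: (a i) => [r| |]//.
      rewrite lte_fin => Lr.
      have := cx i => /cvgr_lt /(_ _ Lr).
      by apply: filterS => k; rewrite lte_fin.
    by move=> _; apply: nearW => k; rewrite ltry.
  - by apply: filterS (FE n) => k ->.
(* If [L x] is outside the open cylinder, [F k x] need not be, but it is
   eventually outside the slightly smaller one. *)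
pose b j i := a i - (j.+1%:R^-1)%:E.
have nub j : nu (half_cylinder n (b j)) <= P (L @^-1` half_cylinder n a).
  have mc := mpre _ n a mL.
  have : P (~` (L @^-1` half_cylinder n a)) <= 1 - nu (half_cylinder n (b j)).
    apply: (@measure_le_liminf _ (fun k => ~` (F k @^-1` half_cylinder n (b j)))).
    - exact: measurableC.
    - by move=> k; apply: measurableC; exact: mpre.
    - apply: filterS acF => x cx /= /existsNP[i /not_implyP[im /negP]].
      rewrite -leNgt => ai.
      suff : \forall k \near \oo, b j i <= (F k x i)%:E.
        by apply: filterS => k bF /(_ i im); rewrite ltNge bF.
      move: ai; rewrite /b; case: (a i) => [r| |]//.
        rewrite lee_fin => rL.
        have : (r - j.+1%:R^-1 < L x i)%R.
          by rewrite (lt_le_trans _ rL)// ltrBlDr ltrDl invr_gt0.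
        have := cx i => /cvgr_gt /[apply].
        by apply: filterS => k /ltW; rewrite lee_fin.
      by move=> _; apply: nearW => k; rewrite leNye.
    - apply: filterS (FE n) => k Fk.
      by rewrite probability_setC ?Fk//; exact: mpre.
  rewrite probability_setC//.
  rewrite -(fineK (fin_num_measure P _ mc)) -(fineK (fin_num_measure nu _ (mH n (b j)))).
  by rewrite -!EFinB !lee_fin lerD2l lerN2.
(* The smaller cylinders exhaust the original one because its inequalities are strict, so [nub]
   passes to the limit by continuity of [nu] from below. *)
have ndb : nondecreasing_seq (fun j => half_cylinder n (b j)).
  move=> j k jk; apply/subsetPset => x xb i im.
  apply: (lt_le_trans (xb i im)); rewrite /b leeB// lee_fin.
  by rewrite lef_pV2 ?posrE ?ltr0n// ler_nat.
have abE : half_cylinder n a = \bigcup_j half_cylinder n (b j).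
  apply/seteqP; split=> [x xa|x [j _ xb] i im]; last first.
    apply: (lt_le_trans (xb i im)); rewrite /b.
    case: (a i) => [r| |]//=.
    by rewrite lee_fin gerBl invr_ge0.
  suff [j _ /(_ j (leqnn j)) h] : \forall j \near \oo, forall i : 'I_n, (x i)%:E < b j i.
    by exists j => // i im; exact: (h (Ordinal im)).
  apply: filter_forall => i; have := xa i (ltn_ord i).
  rewrite /b; case: (a i) => [r| |]//.
    rewrite lte_fin -subr_gt0 => xr.
    have := near_infty_natSinv_lt (PosNum xr).
    by apply: filterS => j /=; rewrite lte_fin ltrBrDr -ltrBrDl.
  by move=> _; apply: nearW => j; rewrite ltry.
rewrite abE.
have := @nondecreasing_cvg_mu _ _ _ nu _ (fun j => mH n (b j))
  (bigcupT_measurable _ (fun j => mH n (b j))) ndb.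
move=> /cvg_lim <-//; rewrite -abE; apply: lime_le; last exact: nearW.
by apply: ereal_nondecreasing_is_cvgn => m p mp; apply: le_measure;
    rewrite ?inE//; exact/subsetPset/ndb.
Qed.

End law_of_limit.

Section ae_convergence.
Context d (T : measurableType d) (R : realType).
Variable P : {measure set T -> \bar R}.

Lemma is_cvg_nonneg_series (u : R^nat) (M : R) : (forall k, 0 <= u k) ->
  (forall n, \sum_(0 <= k < n) u k <= M) -> cvgn (series u).
Proof.
move=> u0 uM; apply: nondecreasing_is_cvgn.
  by apply: nondecreasing_series => n _ _; exact: u0.
by exists M => _ [n _ <-]; exact: uM.
Qed.

(** The squared increments divided by [h k] have a summable sequence of integrals, so their sum is
    finite almost everywhere; this makes the increments absolutely summable. *)
Lemma ae_cvg_of_sqr_increments (f : nat -> T -> R) (h : R^nat) (M : R) :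
  (forall k, 0 < h k) -> (forall n, \sum_(0 <= k < n) h k <= M) ->
  (forall k, measurable_fun setT (f k)) ->
  (forall k, (\int[P]_x ((f k.+1 x - f k x) ^+ 2)%:E <= (h k ^+ 2)%:E)%E) ->
  {ae P, forall x, cvgn (f ^~ x)}.
Proof.
move=> h0 hM mf fh.
pose e k x := (h k)^-1 * (f k.+1 x - f k x) ^+ 2.
have e0 k x : 0 <= e k x by rewrite mulr_ge0 ?sqr_ge0// invr_ge0 ltW.
have me k : measurable_fun setT (e k).
  apply: measurable_funM => //; apply: measurable_funX.
  exact: measurable_funB.
have ie k : (\int[P]_x (e k x)%:E <= (h k)%:E)%E.
  under eq_integral do rewrite EFinM.
  rewrite ge0_integralZl//; last 3 first.
  - apply/measurable_EFinP; apply: measurable_funX; exact: measurable_funB.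
  - by move=> x _; rewrite lee_fin sqr_ge0.
  - by rewrite lee_fin invr_ge0 ltW.
  apply: (le_trans (lee_wpmul2l _ (fh k))); first by rewrite lee_fin invr_ge0 ltW.
  by rewrite -EFinM lee_fin expr2 mulKf// gt_eqF.
pose S x := (\sum_(k <oo) (e k x)%:E)%E.
have iS : P.-integrable setT S.
  apply/integrableP; split.
    apply: ge0_emeasurable_sum => // [k x _ _|k _]; first by rewrite lee_fin.
    exact/measurable_EFinP.
  under eq_integral => x _.
    rewrite gee0_abs; last by apply: nneseries_ge0 => k _ _; rewrite lee_fin.
    over.
  rewrite integral_nneseries//; last 2 first.
  - by move=> k; apply/measurable_EFinP.
  - by move=> k x _; rewrite lee_fin.
  apply: (@le_lt_trans _ _ M%:E); last exact: ltry.
  apply: lime_le.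
    by apply: is_cvg_nneseries => k _ _; apply: integral_ge0 => x _; rewrite lee_fin.
  apply: nearW => n; apply: (@le_trans _ _ (\sum_(0 <= k < n) (h k)%:E)%E).
    by apply: lee_sum => k _; exact: ie.
  by rewrite sumEFin lee_fin.
apply: filterS (integrable_ae measurableT iS) => x /(_ I) Sx.
have ce : cvgn (series (e ^~ x)).
  apply: (@is_cvg_nonneg_series _ (fine (S x))) => // n.
  rewrite -lee_fin fineK// -sumEFin.
  by apply: nneseries_lim_ge => k _ _; rewrite lee_fin.
have ch : cvgn (series h).
  by apply: (@is_cvg_nonneg_series _ M) => // k; exact: ltW.
have cd : cvgn (series (telescope (f ^~ x))).
  apply: normed_cvg; apply: (@series_le_cvg _ _ (fun k => h k + e k x)) => //.
  - by move=> k; exact: normr_ge0.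
  - by move=> k; rewrite addr_ge0// ltW.
  (* [|D| <= h + D^2 / h] *)
  - move=> k; rewrite /telescope /= /e; set D := f k.+1 x - f k x.
    rewrite -(real_normK (num_real D)); set t := `|D|.
    have [th|ht] := leP t (h k).
      by rewrite ler_wpDr// mulr_ge0 ?sqr_ge0// invr_ge0 ltW.
    apply: ler_wpDl; first exact: ltW.
    rewrite ler_pdivlMl//.
    by rewrite expr2 ler_wpM2r ?normr_ge0// ltW.
  - rewrite (_ : (fun k => h k + e k x) = h + (e ^~ x)) // seriesD.
    exact: is_cvgD.
rewrite (_ : f ^~ x = fun n => f 0%N x + series (telescope (f ^~ x)) n).
  by apply: is_cvgD => //; exact: is_cvg_cst.
by apply/funext => n; rewrite -eq_sum_telescope.
Qed.

(** The upper limit is measurable whether or not the sequence converges. [fine] sends its infinite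
    values to 0, which happens only at points of divergence. *)
Lemma measurable_ae_lim (f : nat -> T -> R) :
  (forall k, measurable_fun setT (f k)) -> {ae P, forall x, cvgn (f ^~ x)} ->
  exists2 g : T -> R, measurable_fun setT g &
    {ae P, forall x, f k x @[k --> \oo] --> g x}.
Proof.
move=> mf cf; exists (fun x => fine (limn_esup (fun k => (f k x)%:E))).
  apply: measurableT_comp => //.
  by apply: measurable_fun_limn_esup => k; exact/measurable_EFinP.
apply: filterS cf => x cx.
have cxE : (f k x)%:E @[k --> \oo] --> (limn (f ^~ x))%:E.
  by apply: cvg_EFin; [exact: nearW|exact: cx].
rewrite is_cvg_limn_esupE; last by apply/cvg_ex; eexists; exact: cxE.
by rewrite (cvg_lim _ cxE).
Qed.

Local Open Scope ereal_scope.

Lemma integral_ae_lim_le (f : nat -> T -> \bar R) (g : T -> \bar R) (c : \bar R) :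
  (forall k, measurable_fun setT (f k)) -> (forall k x, 0 <= f k x) ->
  measurable_fun setT g -> {ae P, forall x, f k x @[k --> \oo] --> g x} ->
  (forall k, \int[P]_x f k x <= c) -> \int[P]_x g x <= c.
Proof.
move=> mf f0 mg fg fc.
have mlf : measurable_fun setT (fun x => limn_einf (f ^~ x)).
  rewrite (_ : (fun _ => _) = \- (fun x => limn_esup (fun k => - f k x))); last first.
    by apply/funext => x /=; rewrite limn_esupN oppeK.
  apply: measurableT_comp => //; apply: measurable_fun_limn_esup => k.
  exact: measurableT_comp.
rewrite (ae_eq_integral (fun x => limn_einf (f ^~ x)) g measurableT mg mlf); last first.
  by apply: filterS fg => x /cvg_limn_einf_sup[-> _].
apply: (le_trans (fatou P measurableT mf (fun k x _ => f0 k x))).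
rewrite limn_einf_lim; apply: lime_le; first exact: is_cvg_einfs.
apply: nearW => k; apply: (@le_trans _ _ (\int[P]_x f k x)) => //.
by apply: ereal_inf_lbound; exists k => /=.
Qed.

End ae_convergence.

(** * Equivariant maps *)

Section permutations_of_coordinates.
Variable R : realType.
Notation Rinf := (borel (Rinfty R)).
Implicit Types x : Rinf.

Definition perm_nat n (s : 'S_n) (i : nat) : nat :=
  if insub i is Some j then s j else i.

Lemma perm_coordE n (s : 'S_n) x i : perm_coord s x i = x (perm_nat s i).
Proof. by rewrite /perm_coord /perm_nat; case: insub. Qed.

Lemma perm_nat_ord n (s : 'S_n) (i : 'I_n) : perm_nat s i = s i.
Proof. by rewrite /perm_nat valK. Qed.

Lemma perm_nat_ge n (s : 'S_n) i : (n <= i)%N -> perm_nat s i = i.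
Proof. by move=> ni; rewrite /perm_nat insubF// ltnNge ni. Qed.

Lemma perm_nat_lt n (s : 'S_n) i : (i < n)%N -> (perm_nat s i < n)%N.
Proof. by move=> ni; rewrite (perm_nat_ord s (Ordinal ni)). Qed.

Lemma perm_nat_mul n (s t : 'S_n) i :
  perm_nat (s * t)%g i = perm_nat t (perm_nat s i).
Proof.
have [ni|ni] := ltnP i n; last by rewrite !perm_nat_ge.
by rewrite !(perm_nat_ord _ (Ordinal ni)) permM perm_nat_ord.
Qed.

Lemma perm_nat_id n i : perm_nat (1%g : 'S_n) i = i.
Proof.
have [ni|ni] := ltnP i n; last by rewrite !perm_nat_ge.
by rewrite (perm_nat_ord _ (Ordinal ni)) perm1.
Qed.

Lemma perm_nat_inj n (s : 'S_n) : injective (perm_nat s).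
Proof.
apply: (can_inj (g := perm_nat s^-1%g)) => i.
by rewrite -perm_nat_mul mulgV perm_nat_id.
Qed.

(** Extending by the identity lets maps of any dimension [m >= n] be tested against permutations of
    the first [n] coordinates. *)
Lemma perm_nat_widen n m (s : 'S_n) : (n <= m)%N ->
  exists t : 'S_m, perm_nat t =1 perm_nat s.
Proof.
move=> nm.
have sm (i : 'I_m) : (perm_nat s i < m)%N.
  have [ni|ni] := ltnP i n; last by rewrite perm_nat_ge.
  exact: leq_trans (perm_nat_lt s ni) nm.
have inj : injective (fun i : 'I_m => Ordinal (sm i)).
  by move=> i j [] /perm_nat_inj/val_inj.
exists (perm inj) => i; have [mi|mi] := ltnP i m.
  by rewrite (perm_nat_ord _ (Ordinal mi)) permE.
by rewrite !perm_nat_ge// (leq_trans nm).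
Qed.

Lemma perm_coord_widen n m (s : 'S_n) : (n <= m)%N ->
  exists t : 'S_m, @perm_coord R m t = perm_coord s.
Proof.
move=> /(perm_nat_widen s)[t ts]; exists t.
by apply/funext => x; apply/funext => i; rewrite !perm_coordE ts.
Qed.

Lemma perm_coordK n (s : 'S_n) : cancel (@perm_coord R n s) (perm_coord s^-1%g).
Proof.
move=> x; apply/funext => i.
by rewrite !perm_coordE -perm_nat_mul mulVg perm_nat_id.
Qed.

(** Both are widened to a common size. The product of permutations applies its left factor first,
    whence the order [t' * s']. *)
Lemma perm_coord_comp n m (s : 'S_n) (t : 'S_m) : exists p (r : 'S_p),
  perm_nat r =1 perm_nat s \o perm_nat t.
Proof.
have [s' s'E] := perm_nat_widen s (leq_maxl n m).
have [t' t'E] := perm_nat_widen t (leq_maxr n m).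
by exists (maxn n m), (t' * s')%g => i; rewrite perm_nat_mul s'E t'E.
Qed.

Lemma measurable_perm_coord n (s : 'S_n) : measurable_fun setT (@perm_coord R n s).
Proof.
apply: measurable_Rinfty => i.
rewrite (_ : (fun _ => _) = fun x : Rinf => x (perm_nat s i)).
  exact: measurable_eval.
by apply/funext => x; rewrite perm_coordE.
Qed.

Lemma ae_perm_coord (mu : probability Rinf R) n (s : 'S_n) (Q : Rinf -> Prop) :
  exchangeable mu -> {ae mu, forall x, Q x} -> {ae mu, forall x, Q (perm_coord s x)}.
Proof.
move=> emu [N [mN N0 QN]]; exists (perm_coord s @^-1` N); split.
- by rewrite -[X in measurable X]setTI; exact: measurable_perm_coord.
- by have := emu n s _ mN; rewrite /pushforward N0.
- by move=> x /= nQ; exact: QN.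
Qed.

Section equivariant_modification.
Variables (mu : probability Rinf R) (L : Rinf -> Rinf).
Hypothesis mL : measurable_fun setT L.
Hypothesis aeL : forall n (s : 'S_n),
  {ae mu, forall x, L (perm_coord s x) = perm_coord s (L x)}.

Let G : set Rinf :=
  [set x | forall n (s : 'S_n), L (perm_coord s x) = perm_coord s (L x)].

(* [G] is an invariant set of full measure; outside it [L] is replaced by the
   identity, which is equivariant. *)
Let measurable_G : measurable G.
Proof.
pose N n (s : 'S_n) i : set Rinf :=
  [set x | (L (perm_coord s x) i : R) != perm_coord s (L x) i].
have mN n (s : 'S_n) i : measurable (N n s i).
  have m1 : measurable_fun setT (fun x => perm_coord s (L x) i : R).
    apply: (@measurable_eval_comp _ _ _ (fun x => perm_coord s (L x))).
    by apply: measurableT_comp mL; exact: measurable_perm_coord.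
  have m2 : measurable_fun setT (fun x => L (perm_coord s x) i : R).
    apply: (@measurable_eval_comp _ _ _ (fun x => L (perm_coord s x))).
    by apply: (measurableT_comp mL); exact: measurable_perm_coord.
  have := measurable_fun_eqr m2 m1; move=> /(_ measurableT [set false] I).
  rewrite setTI; congr (measurable _).
  by apply/seteqP; split=> x /=; rewrite /N /=; case: eqP.
(* The union is countable because each ['S_n] is finite. *)
rewrite (_ : G = ~` \bigcup_n \bigcup_(s : 'S_n) \bigcup_i N n s i).
  apply: measurableC; apply: bigcupT_measurable => n.
  apply: countable_bigcupT_measurable => [|s]; first exact: countableP.
  exact: bigcupT_measurable.
apply/seteqP; split=> [x xG [n _ [s _ [i _ /=]]]|x xN n s].
  by rewrite /N /= xG eqxx.
apply/funext => i; apply/eqP; apply: contrapT => /negP xs.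
by apply: xN; exists n => //; exists s => //; exists i.
Qed.

(** [G] quantifies over permutations of all sizes, and two successive permutations form a third, at
    which [x] may again be tested. *)
Let G_perm n (s : 'S_n) x : G x -> G (perm_coord s x).
Proof.
move=> xG m t; have [p [r rE]] := perm_coord_comp s t.
have -> : perm_coord t (perm_coord s x) = perm_coord r x.
  by apply/funext => i; rewrite !perm_coordE rE.
by rewrite !xG; apply/funext => i; rewrite !perm_coordE rE.
Qed.

Lemma equivariant_modification : exists T : {mfun Rinf >-> Rinf},
  exchangeable_map T /\ {ae mu, forall x, T x = L x}.
Proof.
pose T x := if x \in G then L x else x.
have mT : measurable_fun setT T.
  apply: measurable_fun_ifT => //.
  apply: (@measurable_fun_bool _ _ _ _ true); rewrite setTI.
  rewrite (_ : _ @^-1` _ = G)//.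
  by apply/seteqP; split=> x; [move=> /set_mem|move=> /mem_set].
pose T' : {mfun Rinf >-> Rinf} := HB.pack T (isMeasurableFun.Build _ _ _ _ T mT).
exists T'; split.
  move=> n s; apply/funext => x; rewrite /T' /= /T.
  have [|xG] := boolP (x \in G).
    rewrite inE => xG; rewrite mem_set; first exact: xG.
    exact: G_perm.
  (* The complement of [G] is invariant too, by applying the inverse permutation; so both sides use
     the identity branch. *)
  rewrite ifN//; apply: contra xG; rewrite !inE => /(G_perm (s^-1)%g).
  by rewrite perm_coordK.
have : {ae mu, forall x, G x}.
  apply/ae_foralln => n; apply: (@filter_forall _ _ _ _ (ae_filter_ringOfSetsType mu)).
  by move=> s; exact: aeL.
by apply: filterS => x xG; rewrite /T' /= /T mem_set.
Qed.

End equivariant_modification.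

End permutations_of_coordinates.

Section continuity_rV.
Context {R : realType}.

Lemma continuous_rV {S : topologicalType} n (f : S -> 'rV[R]_n) :
  (forall i, continuous (fun x => f x ord0 i)) -> continuous f.
Proof.
move=> cf x A [B nB sBA].
have nQ : nbhs x [set y | forall i, B ord0 i (f y ord0 i)].
  apply: (@filter_forall _ _ (fun i y => B ord0 i (f y ord0 i)) (nbhs x)) => i.
  exact: (cf i x _ (nB ord0 i)).
by apply: filterS nQ => y yB; apply: sBA => i j; rewrite (ord1 i); exact: yB.
Qed.

Definition reindex_rV n m (h : 'I_n -> 'I_m) (v : borel 'rV[R]_m) : borel 'rV[R]_n :=
  \row_i v ord0 (h i).

Lemma measurable_reindex_rV n m (h : 'I_n -> 'I_m) :
  measurable_fun setT (reindex_rV h).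
Proof.
apply: (@continuous_borel_measurable 'rV[R]_m 'rV[R]_n (reindex_rV h)).
apply: continuous_rV => i.
rewrite (_ : (fun _ => _) = fun v : 'rV[R]_m => v ord0 (h i)).
  exact: coord_continuous.
by apply/funext => v; rewrite mxE.
Qed.

(** This carries the law of an n-dimensional projection, which is what optimality of [T_ n]
    provides, over to half-cylinders. *)
Lemma half_cylinder_proj_coord n (a : nat -> \bar R) :
  exists2 B : set (borel 'rV[R]_n), measurable B &
    half_cylinder n a = proj_coord n @^-1` B.
Proof.
pose B (i : 'I_n) : set (borel 'rV[R]_n) := [set v | ((v ord0 i : R)%:E < a i)%E].
exists (\bigcap_(i in [set: 'I_n]) B i).
  apply: fin_bigcap_measurable => // i _.
  rewrite -[X in measurable X]setTI; apply: emeasurable_fun_infty_o => //.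
  by apply/measurable_EFinP; exact: measurable_coord.
apply/seteqP; split=> x xa i; first by move=> _; rewrite /B /= mxE; exact: xa.
by move=> ni; have := xa (Ordinal ni) I; rewrite /B /= mxE.
Qed.

End continuity_rV.

Section exchangeable_moments.
Variables (R : realType) (mu : probability (borel (Rinfty R)) R).
Hypothesis emu : exchangeable mu.
Notation Rinf := (borel (Rinfty R)).

Lemma ge0_integral_perm n (s : 'S_n) (f : Rinf -> \bar R) :
  measurable_fun setT f -> (forall x, 0 <= f x)%E ->
  (\int[mu]_x f (perm_coord s x) = \int[mu]_x f x)%E.
Proof.
move=> mf f0; apply: (ge0_integral_eq_law (Y := id)) => //.
  exact: measurable_perm_coord.
by move=> A mA; exact: emu.
Qed.

Lemma integral_perm n (s : 'S_n) (f : Rinf -> \bar R) :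
  measurable_fun setT f -> mu.-integrable setT f ->
  (\int[mu]_x f (perm_coord s x) = \int[mu]_x f x)%E.
Proof.
move=> mf fi; apply: (integral_eq_law (Y := id)) => //.
  exact: measurable_perm_coord.
by move=> A mA; exact: emu.
Qed.

Lemma transposition_exists i n : (i < n)%N -> exists s : 'S_n,
  perm_nat s 0 = i /\ perm_nat s i = 0%N.
Proof.
move=> ni; have n0 : (0 < n)%N by exact: leq_ltn_trans ni.
exists (tperm (Ordinal n0) (Ordinal ni)).
by rewrite (perm_nat_ord _ (Ordinal n0)) (perm_nat_ord _ (Ordinal ni)) tpermL tpermR.
Qed.

Lemma exchangeable_Lfun2 i : (\int[mu]_x ((x 0%N) ^+ 2)%:E < +oo)%E ->
  (fun x : Rinf => x i : R) \in Lfun mu 2%:E.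
Proof.
move=> m2; apply: Lfun2_of_sqr; first exact: measurable_eval.
have [s [s0 _]] := transposition_exists (ltnSn i).
apply: le_lt_trans m2.
rewrite -(ge0_integral_perm s (f := fun x : Rinf => ((x 0%N : R) ^+ 2)%:E)).
- by under [leRHS]eq_integral do rewrite perm_coordE s0.
- by apply/measurable_EFinP; apply: measurable_funX; exact: measurable_eval.
- by move=> x; rewrite lee_fin sqr_ge0.
Qed.

(** Swapping coordinates 0 and [i] preserves [mu] and, by equivariance, turns coordinate 0 of [U]
    and [V] into coordinate [i]. *)
Lemma integral_sqr_dist_coord n (U V : Rinf -> Rinf) i :
  measurable_fun setT U -> measurable_fun setT V ->
  (forall s : 'S_n, {ae mu, forall x, U (perm_coord s x) = perm_coord s (U x)}) ->
  (forall s : 'S_n, {ae mu, forall x, V (perm_coord s x) = perm_coord s (V x)}) ->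
  (i < n)%N ->
  (\int[mu]_x ((U x i - V x i) ^+ 2)%:E = \int[mu]_x ((U x 0%N - V x 0%N) ^+ 2)%:E)%E.
Proof.
move=> mU mV eU eV /transposition_exists[s [s0 _]].
have mUV j : measurable_fun setT (fun x => ((U x j - V x j : R) ^+ 2)%:E).
  apply/measurable_EFinP; apply: measurable_funX.
  by apply: measurable_funB; exact: measurable_eval_comp.
rewrite -(ge0_integral_perm s (mUV 0%N)); last by move=> x; rewrite lee_fin sqr_ge0.
apply: ae_eq_integral => //.
  by apply: (measurableT_comp (mUV 0%N)); exact: measurable_perm_coord.
apply: filterS2 (eU s) (eV s) => x -> -> _.
by rewrite !perm_coordE s0.
Qed.

End exchangeable_moments.

(** * Convergence of the finite-dimensional maps *)

Section finite_dimensional_maps.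
Variables (R : realType) (mu nu : probability (borel (Rinfty R)) R).
Notation Rinf := (borel (Rinfty R)).
Hypotheses (emu : exchangeable mu) (enu : exchangeable nu).
Hypothesis mu2 : forall i, (fun x : Rinf => x i : R) \in Lfun mu 2%:E.
Hypothesis nu2 : forall i, (fun x : Rinf => x i : R) \in Lfun nu 2%:E.
Variable Phi : forall n, 'rV[R]_n -> R.
Variable T_ : forall n, {mfun borel 'rV[R]_n >-> borel 'rV[R]_n}.
Hypothesis cPhi : forall n, (0 < n)%N -> convex_function [set: 'rV[R]_n] (Phi (n := n)).
Hypothesis dPhi : forall n, (0 < n)%N -> forall x, differentiable (Phi (n := n)) x.
Hypothesis TE : forall n, (0 < n)%N -> forall x, T_ n x = gradient (Phi (n := n)) x.
Hypothesis optT : forall n, (0 < n)%N ->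
  optimal_map (distribution mu (proj_coord n)) (distribution nu (proj_coord n)) (T_ n).
Variable K : R.
Hypothesis K0 : 0 < K.
Hypothesis PhiK : forall n, (0 < n)%N -> forall a b : 'rV[R]_n,
  Phi a - Phi b - dot (gradient (Phi (n := n)) b) (a - b) <= K * enorm (a - b) ^+ 2.

(** The identity beyond [n] makes all the [T_ n] self-maps of one space. It does not affect limits,
    since coordinate [i] is given by [T_ n] as soon as [n > i]. *)
Definition lift_map n (x : Rinf) : Rinf :=
  fun i => if insub i is Some j then T_ n (proj_coord n x) ord0 j else x i.

Lemma lift_map_ord n (i : 'I_n) x : lift_map n x i = T_ n (proj_coord n x) ord0 i.
Proof. by rewrite /lift_map valK. Qed.

Lemma lift_map_ge n i x : (n <= i)%N -> lift_map n x i = x i.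
Proof. by move=> ni; rewrite /lift_map insubF// ltnNge ni. Qed.

Lemma proj_lift_map n x : proj_coord n (lift_map n x) = T_ n (proj_coord n x).
Proof. by apply/rowP => i; rewrite mxE lift_map_ord. Qed.

Lemma measurable_lift_map n : measurable_fun setT (lift_map n).
Proof.
apply: measurable_Rinfty => i; have [ni|ni] := ltnP i n; last first.
  rewrite (_ : (fun _ => _) = fun x : Rinf => x i); first exact: measurable_eval.
  by apply/funext => x; rewrite lift_map_ge.
rewrite (_ : (fun _ => _) = (fun v : borel 'rV[R]_n => v ord0 (Ordinal ni)) \o
    (T_ n \o proj_coord n)); last first.
  by apply/funext => x; rewrite (lift_map_ord (Ordinal ni)).
apply: measurableT_comp; first exact: measurable_coord.
exact: measurableT_comp.
Qed.

(** [A] is pulled back to m coordinates, where the second marginal of the optimal coupling applies.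
    For [n < m] this makes the truncation of [T_ m] an admissible competitor of [T_ n]. *)
Lemma law_proj_lift_map n m (A : set (borel 'rV[R]_n)) : (n <= m)%N -> (0 < m)%N ->
  measurable A ->
  mu ((proj_coord n \o lift_map m) @^-1` A) = nu (proj_coord n @^-1` A).
Proof.
move=> nm m0 mA.
have pE (x : Rinf) : proj_coord n x = reindex_rV (widen_ord nm) (proj_coord m x).
  by apply/rowP => i; rewrite !mxE.
have [[_ h] _] := optT m0.
have mB : measurable (reindex_rV (widen_ord nm) @^-1` A).
  by rewrite -[X in measurable X]setTI; exact: measurable_reindex_rV.
rewrite (_ : proj_coord n @^-1` A =
    proj_coord m @^-1` (reindex_rV (widen_ord nm) @^-1` A)); last first.
  by apply/seteqP; split=> x /=; rewrite -pE.
apply: (etrans _ (h _ mB)); congr (mu _).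
by apply/seteqP; split=> x /=; rewrite pE proj_lift_map.
Qed.

Lemma Lfun2_of_law n (Y : Rinf -> borel 'rV[R]_n) : measurable_fun setT Y ->
  (forall A, measurable A -> mu (Y @^-1` A) = nu (proj_coord n @^-1` A)) ->
  forall i, (fun x => Y x ord0 i) \in Lfun mu 2%:E.
Proof.
move=> mY YE i; apply: Lfun2_of_sqr.
  exact: (measurableT_comp (measurable_coord i) mY).
rewrite (ge0_integral_eq_law mY (measurable_proj_coord (n := n)) YE
  (f := fun u => (u ord0 i ^+ 2)%:E)).
- have := Lfun2_mul_integrable (nu2 i) (nu2 i).
  move/(integrable_lty measurableT) => /=; apply: le_lt_trans.
  by under eq_integral do rewrite mxE expr2.
- by apply/measurable_EFinP; apply: measurable_funX; exact: measurable_coord.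
- by move=> u; rewrite lee_fin sqr_ge0.
Qed.

Lemma lift_map_Lfun2 n i : (0 < n)%N -> (fun x => lift_map n x i : R) \in Lfun mu 2%:E.
Proof.
move=> n0; have [ni|ni] := ltnP i n; last first.
  rewrite (_ : (fun _ => _) = fun x : Rinf => x i); first exact: mu2.
  by apply/funext => x; rewrite lift_map_ge.
have mY : measurable_fun setT (proj_coord n \o lift_map n).
  by apply: measurableT_comp => //; exact: measurable_lift_map.
have := Lfun2_of_law mY (fun A => law_proj_lift_map (leqnn n) n0) (Ordinal ni).
rewrite (_ : (fun _ => _) = fun x => lift_map n x i)//.
by apply/funext => x; rewrite mxE.
Qed.

Lemma stability_lift_map n (Y : Rinf -> borel 'rV[R]_n) : (0 < n)%N ->
  measurable_fun setT Y ->
  (forall A, measurable A -> mu (Y @^-1` A) = nu (proj_coord n @^-1` A)) ->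
  \int[mu]_x dot (Y x - T_ n (proj_coord n x)) (Y x - T_ n (proj_coord n x)) <=
  4 * K * \int[mu]_x dot (proj_coord n x) (T_ n (proj_coord n x) - Y x).
Proof.
move=> n0 mY YE.
apply: (gradient_stability _ (TE n0) (dPhi n0) (cPhi n0) K0 (PhiK n0)) => //.
- move=> i; rewrite (_ : (fun _ => _) = fun x : Rinf => x i); first exact: mu2.
  by apply/funext => x; rewrite mxE.
- exact: Lfun2_of_law YE.
- move=> A mA; rewrite YE// -(law_proj_lift_map (leqnn n) n0 mA).
  by congr (mu _); apply/seteqP; split=> x /=; rewrite proj_lift_map.
Qed.

Lemma integrable_dot_lift n (Y : Rinf -> borel 'rV[R]_n) : (0 < n)%N ->
  (forall i, (fun x => Y x ord0 i) \in Lfun mu 2%:E) ->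
  mu.-integrable setT (EFin \o (fun x => dot (proj_coord n x) (Y x))).
Proof.
move=> n0 Y2; apply: integrable_dot => // i.
rewrite (_ : (fun _ => _) = fun x : Rinf => x i); first exact: mu2.
by apply/funext => x; rewrite mxE.
Qed.

Lemma T_proj_Lfun2 n : (0 < n)%N ->
  forall i, (fun x : Rinf => T_ n (proj_coord n x) ord0 i) \in Lfun mu 2%:E.
Proof.
move=> n0 i; rewrite (_ : (fun _ => _) = fun x => lift_map n x i).
  exact: lift_map_Lfun2.
by apply/funext => x; rewrite lift_map_ord.
Qed.

(** The conjugate [Y] of [T_ n] by [s] has the right law and the same correlation with [x] as
    [T_ n], so the stability bound is 0. *)
Lemma lift_map_equivariant_ord n (s : 'S_n) : (0 < n)%N ->
  {ae mu, forall x, lift_map n (perm_coord s x) = perm_coord s (lift_map n x)}.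
Proof.
move=> n0.
have projE (t : 'S_n) (x : Rinf) :
    proj_coord n (perm_coord t x) = reindex_rV t (proj_coord n x).
  by apply/rowP => i; rewrite !mxE perm_coordE perm_nat_ord.
pose W := proj_coord n \o lift_map n.
have mW : measurable_fun setT W.
  by apply: measurableT_comp => //; exact: measurable_lift_map.
pose Z : Rinf -> borel 'rV[R]_n := reindex_rV (s^-1)%g \o W.
have mZ : measurable_fun setT Z.
  by apply: measurableT_comp mW; exact: measurable_reindex_rV.
pose Y := Z \o perm_coord s.
have mY : measurable_fun setT Y.
  by apply: measurableT_comp mZ _; exact: measurable_perm_coord.
have YE A : measurable A -> mu (Y @^-1` A) = nu (proj_coord n @^-1` A).
  move=> mA.
  have mZA : measurable (Z @^-1` A).
    by rewrite -[X in measurable X]setTI; exact: mZ.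
  have mrA : measurable (reindex_rV (s^-1)%g @^-1` A : set (borel 'rV[R]_n)).
    by rewrite -[X in measurable X]setTI; exact: measurable_reindex_rV.
  have mpA : measurable (proj_coord n @^-1` A : set Rinf).
    by rewrite -[X in measurable X]setTI; exact: measurable_proj_coord.
  (* Invariance of [mu] removes the inner permutation, and invariance of [nu] the outer one. *)
  apply: (etrans (emu s mZA)); apply: (etrans (law_proj_lift_map (leqnn n) n0 mrA)).
  apply: (etrans _ (enu (s^-1)%g mpA)); congr (nu _).
  by apply/seteqP; split=> x /=; rewrite projE.
have Y2 := Lfun2_of_law mY YE.
have T2 := T_proj_Lfun2 n0.
(* The inner product is unchanged when both arguments are permuted, so this is the integrand of
   [T_ n] evaluated at the permuted point. *)
have dotXY x : dot (proj_coord n x) (Y x) =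
    dot (proj_coord n (perm_coord s x)) (T_ n (proj_coord n (perm_coord s x))).
  rewrite /dot (reindex_inj (@perm_inj _ s)); apply: eq_bigr => i _.
  by rewrite /Y /Z /W /= proj_lift_map !mxE permK perm_coordE perm_nat_ord.
have iXT := integrable_dot_lift n0 T2.
have iXY := integrable_dot_lift n0 Y2.
have eXY : \int[mu]_x dot (proj_coord n x) (Y x) =
    \int[mu]_x dot (proj_coord n x) (T_ n (proj_coord n x)).
  rewrite /Rintegral; congr fine.
  under eq_integral do rewrite dotXY.
  apply: (integral_perm emu s (f := EFin \o fun x : Rinf =>
    dot (proj_coord n x) (T_ n (proj_coord n x)))) => //.
  exact: (measurable_int _ iXT).
have := stability_lift_map n0 mY YE.
under [X in _ <= _ * X]eq_Rintegral do rewrite dotBr.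
rewrite (RintegralB measurableT iXT iXY) eXY subrr mulr0.
pose D x := Y x - T_ n (proj_coord n x).
have D2 i : (fun x => D x ord0 i) \in Lfun mu 2%:E.
  rewrite (_ : (fun _ => _) = fun x => Y x ord0 i - T_ n (proj_coord n x) ord0 i).
    exact: (Lfun2B (Y2 i) (T2 i)).
  by apply/funext => x; rewrite !mxE.
have iD := integrable_dot D2 D2.
rewrite -/(D _) => D0.
have {}D0 : (\int[mu]_x (dot (D x) (D x))%:E = 0)%E.
  apply/eqP; rewrite eq_le integral_ge0 ?andbT; last first.
    by move=> x _; rewrite lee_fin dot_ge0.
  by rewrite -(fineK (integrable_fin_num measurableT iD)) lee_fin.
have /(ae_eq_integral_abs mu measurableT (measurable_int _ iD)) :
    (\int[mu]_x `|(EFin \o (fun x => dot (D x) (D x))) x| = 0)%E.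
  by rewrite -[RHS]D0; apply: eq_integral => x _ /=; rewrite ger0_norm// dot_ge0.
apply: filterS => x /(_ I) /= [] /dot_eq0 /subr0_eq YT.
apply/funext => i; rewrite perm_coordE.
have [ni|ni] := ltnP i n; last first.
  by rewrite perm_nat_ge// !lift_map_ge// perm_coordE perm_nat_ge.
(* Reading entry [s i] undoes the outer inverse permutation in [Y]. *)
have := congr1 (fun v : 'rV[R]_n => v ord0 (s (Ordinal ni))) YT.
rewrite /Y /Z /W /= mxE permK mxE => ->.
by rewrite (perm_nat_ord _ (Ordinal ni)) lift_map_ord.
Qed.

Lemma lift_map_equivariant n m (s : 'S_n) : (n <= m)%N -> (0 < m)%N ->
  {ae mu, forall x, lift_map m (perm_coord s x) = perm_coord s (lift_map m x)}.
Proof.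
move=> nm m0; have [t <-] := @perm_coord_widen R _ _ s nm.
exact: lift_map_equivariant_ord.
Qed.
Lemma ae_id_equivariant n (s : 'S_n) :
  {ae mu, forall x, id (perm_coord s x) = perm_coord s (id x)}.
Proof. exact: aeW. Qed.

Definition correlation n := \int[mu]_x (x 0%N * lift_map n x 0%N).

Lemma integrable_correlation n i : (0 < n)%N ->
  mu.-integrable setT (EFin \o fun x : Rinf => x i * lift_map n x i).
Proof. by move=> n0; exact: (Lfun2_mul_integrable (mu2 i) (lift_map_Lfun2 i n0)). Qed.

Lemma correlation_coord n i : (0 < n)%N -> (i < n)%N ->
  \int[mu]_x (x i * lift_map n x i) = correlation n.
Proof.
move=> n0 /transposition_exists[s [s0 _]]; rewrite /correlation /Rintegral.
have iC j := integrable_correlation j n0.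
have mC j := measurable_int _ (iC j).
rewrite -(integral_perm emu s (mC 0%N) (iC 0%N)); congr fine.
apply: ae_eq_integral => //.
- exact: (mC i).
- by apply: (measurableT_comp (mC 0%N)); exact: measurable_perm_coord.
apply: filterS (lift_map_equivariant_ord s n0) => x /= -> _.
by rewrite !perm_coordE s0.
Qed.

(** Stability at dimension [n], with the truncation of [T_ m] as competitor; by equivariance of both
    maps each side is a sum of [n] equal terms. *)
Lemma lift_map_increment n m i : (0 < n)%N -> (n <= m)%N -> (i < n)%N ->
  (\int[mu]_x ((lift_map m x i - lift_map n x i) ^+ 2)%:E <=
   (4 * K * (correlation n - correlation m))%:E)%E.
Proof.
move=> n0 nm ni; have m0 : (0 < m)%N by exact: leq_trans nm.
have mL := measurable_lift_map.
have incE j : (j < n)%N ->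
    (\int[mu]_x ((lift_map m x j - lift_map n x j) ^+ 2)%:E =
     \int[mu]_x ((lift_map m x i - lift_map n x i) ^+ 2)%:E)%E.
  move=> jn; have h k := @integral_sqr_dist_coord _ _ emu n (lift_map m) (lift_map n) k
    (mL m) (mL n) (fun s => lift_map_equivariant s nm m0)
    (fun s => lift_map_equivariant_ord s n0).
  by rewrite !h.
have d2 j : (fun x => lift_map m x j - lift_map n x j) \in Lfun mu 2%:E.
  exact: (Lfun2B (lift_map_Lfun2 j m0) (lift_map_Lfun2 j n0)).
have id2 j := Lfun2_mul_integrable (d2 j) (d2 j).
have mY : measurable_fun setT (proj_coord n \o lift_map m).
  by apply: measurableT_comp => //; exact: mL.
have := stability_lift_map n0 mY (fun A => law_proj_lift_map nm m0).
rewrite [leLHS](_ : _ = \int[mu]_x (\sum_(j < n)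
    (lift_map m x j - lift_map n x j) * (lift_map m x j - lift_map n x j))); last first.
  apply: eq_Rintegral => x _; apply: eq_bigr => j _.
  by rewrite /= -proj_lift_map !mxE.
rewrite [X in _ <= _ * X](_ : _ = \int[mu]_x (\sum_(j < n)
    (x j * lift_map n x j - x j * lift_map m x j))); last first.
  apply: eq_Rintegral => x _; apply: eq_bigr => j _.
  by rewrite /= -proj_lift_map !mxE mulrBr.
rewrite !Rintegral_sum//; last first.
  by move=> j; apply: integrable_subr; exact: integrable_correlation.
under [X in _ <= _ * X]eq_bigr => j _.
  rewrite RintegralB//; [|exact: integrable_correlation..].
  rewrite !correlation_coord ?(leq_trans (ltn_ord j) nm)//.
  over.
pose e := fine (\int[mu]_x ((lift_map m x i - lift_map n x i) ^+ 2)%:E)%E.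
have incR j : (j < n)%N -> \int[mu]_x
    ((lift_map m x j - lift_map n x j) * (lift_map m x j - lift_map n x j)) = e.
  by move=> jn; rewrite /Rintegral /e -(incE j jn).
under [X in X <= _]eq_bigr => j _ do rewrite (incR j (ltn_ord j)).
(* The factor [n] cancels here, leaving a constant independent of the dimension. *)
rewrite !sumr_const card_ord mulrnAr lerMn2r eqn0Ngt n0 /=.
rewrite -lee_fin /e fineK//.
under eq_integral do rewrite expr2.
exact: (integrable_fin_num measurableT (id2 i)).
Qed.
Lemma correlation_nonincreasing n m : (0 < n)%N -> (n <= m)%N ->
  correlation m <= correlation n.
Proof.
move=> n0 nm; have := lift_map_increment n0 nm n0.
move=> /(le_trans _)-/(_ 0%E); rewrite integral_ge0//; last first.
  by move=> x _; rewrite lee_fin sqr_ge0.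
by move=> /(_ isT); rewrite lee_fin pmulr_rge0 ?mulr_gt0// subr_ge0.
Qed.

Lemma correlation_bounded_below : exists B, forall n, (0 < n)%N -> B <= correlation n.
Proof.
(* From [a * b >= - (a ^+ 2 + b ^+ 2)]; the second moment of the image coordinate is that of [nu],
   whatever [n] is. *)
exists (- (\int[mu]_x (x 0%N * x 0%N) + \int[nu]_y (y 0%N * y 0%N))) => n n0.
have i1 := Lfun2_mul_integrable (mu2 0%N) (mu2 0%N).
have i2 := Lfun2_mul_integrable (lift_map_Lfun2 0%N n0) (lift_map_Lfun2 0%N n0).
have iN : mu.-integrable setT (EFin \o fun x : Rinf =>
    (-1) * (x 0%N * x 0%N + lift_map n x 0%N * lift_map n x 0%N)).
  by apply: integrable_mulrl; exact: integrable_addr.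
have -> : \int[nu]_y (y 0%N * y 0%N) = \int[mu]_x (lift_map n x 0%N * lift_map n x 0%N).
  rewrite /Rintegral; congr fine; apply/esym.
  pose i0 : 'I_n := Ordinal n0.
  have mY : measurable_fun setT (proj_coord n \o lift_map n).
    by apply: measurableT_comp => //; exact: measurable_lift_map.
  have lawE := ge0_integral_eq_law mY (measurable_proj_coord (n := n))
    (fun A => law_proj_lift_map (leqnn n) n0)
    (f := fun v : borel 'rV[R]_n => (v ord0 i0 ^+ 2)%:E).
  transitivity (\int[mu]_x ((proj_coord n (lift_map n x)) ord0 i0 ^+ 2)%:E)%E.
    by apply: eq_integral => x _; rewrite mxE expr2.
  apply: (etrans (lawE _ _)).
  - by apply/measurable_EFinP; apply: measurable_funX; exact: measurable_coord.
  - by move=> u; rewrite lee_fin sqr_ge0.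
  - by apply: eq_integral => x _; rewrite mxE expr2.
rewrite -mulN1r -(RintegralD measurableT i1 i2) -RintegralZl//; last first.
  exact: integrable_addr.
apply: le_Rintegral => //; first exact: integrable_correlation.
by move=> x _; nra.
Qed.

Lemma fast_subsequence (h : R^nat) : (forall k, 0 < h k) -> exists ns : nat -> nat,
  [/\ forall k, (k < ns k)%N, forall k, (ns k <= ns k.+1)%N &
      forall k m, (ns k <= m)%N -> correlation (ns k) - correlation m <= h k].
Proof.
move=> h0; have [B cB] := correlation_bounded_below.
pose E := [set correlation n | n in [set n | (0 < n)%N]].
have infE : has_inf E.
  by split; [exists (correlation 1); exists 1%N|exists B => _ [n n0 <-]; exact: cB].
have N_ k : exists N, (0 < N)%N /\ correlation N < inf E + h k.
  by have [_ [N N0 <-] ?] := inf_adherent (h0 k) infE; exists N.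
pose N k := sval (cid (N_ k)).
have [N0 NE] : (forall k, (0 < N k)%N) /\ forall k, correlation (N k) < inf E + h k.
  by split=> k; have [] := svalP (cid (N_ k)).
(* Partial sums of positive integers are nondecreasing and exceed [k]. They also dominate [N k], and
   beyond [N k] every correlation lies within [h k] of the infimum. *)
exists (fun k => \sum_(j < k.+1) N j)%N; split=> [k|k|k m km].
- apply: (@leq_trans (\sum_(j < k.+1) 1)%N); first by rewrite sum1_card card_ord.
  by apply: leq_sum => j _; exact: N0.
- by rewrite [leqRHS]big_ord_recr leq_addr.
- have Nk : (N k <= \sum_(j < k.+1) N j)%N by rewrite big_ord_recr leq_addl.
  have m0 : (0 < m)%N by rewrite (leq_trans (N0 k))// (leq_trans Nk).
  have c1 := correlation_nonincreasing (N0 k) Nk.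
  have c2 : inf E <= correlation m by apply: (inf_lbound infE.2); exists m.
  have c3 := NE k; lra.
Qed.

Lemma lift_map_ae_limit : exists (ns : nat -> nat) (L : Rinf -> Rinf),
  [/\ forall k, (k < ns k)%N, measurable_fun setT L &
      forall i, {ae mu, forall x,
        (lift_map (ns k) x i : R) @[k --> \oo] --> (L x i : R)}].
Proof.
pose h k : R := 2^-1 ^+ k.
have h0 k : 0 < h k by rewrite exprn_gt0// invr_gt0.
have sum_h n : \sum_(0 <= k < n) h k <= 2.
  suff -> : \sum_(0 <= k < n) h k = 2 - 2 * h n.
    by have := h0 n; lra.
  elim: n => [|n ih]; first by rewrite big_geq// /h expr0; lra.
  by rewrite big_nat_recr//= ih /h exprS; lra.
(* The factor cancels the [4 * K] of [lift_map_increment], so squared increments have integral at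
   most [h k ^+ 2]. *)
have [|ns [nsk nsS nsc]] := @fast_subsequence (fun k => (4 * K)^-1 * h k ^+ 2).
  by move=> k; rewrite mulr_gt0 ?exprn_gt0 ?invr_gt0 ?mulr_gt0.
have mF n i : measurable_fun setT (fun x => lift_map n x i : R).
  by apply: measurable_eval_comp; exact: measurable_lift_map.
have aec i : {ae mu, forall x, cvgn (fun k => lift_map (ns k) x i : R)}.
  (* The increment bound for coordinate [i] needs a dimension larger than [i], which the shift
     guarantees from the first term on. *)
  suff : {ae mu, forall x, cvgn (fun k => lift_map (ns (k + i)%N) x i : R)}.
    apply: filterS => x /cvg_ex[l hl]; apply/cvg_ex; exists l.
    by rewrite -(cvg_shiftn i).
  apply: (@ae_cvg_of_sqr_increments _ _ _ mu _ h 2) => // k.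
  have iN : (i < ns (k + i))%N by rewrite (leq_ltn_trans _ (nsk _))// leq_addl.
  apply: (le_trans (lift_map_increment (leq_ltn_trans _ iN) (nsS _) iN)) => //.
  rewrite lee_fin -ler_pdivlMl ?mulr_gt0//.
  apply: (le_trans (nsc _ _ (nsS _))).
  rewrite ler_pM2l ?invr_gt0 ?mulr_gt0//.
  have hle : h (k + i)%N <= h k.
    rewrite /h exprD ler_piMr ?(ltW (h0 k))//.
    by rewrite exprn_ile1// ?invr_ge0// invf_le1//; lra.
  by rewrite lerXn2r// nnegrE ltW.
have /choice[g gP] : forall i, exists g : Rinf -> R, measurable_fun setT g /\
    {ae mu, forall x, (lift_map (ns k) x i : R) @[k --> \oo] --> g x}.
  move=> i; have [g mg gP] := measurable_ae_lim (fun k => mF (ns k) i) (aec i).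
  by exists g.
exists ns, (fun x i => g i x); split => //.
  by apply: measurable_Rinfty => i; exact: (gP i).1.
by move=> i; exact: (gP i).2.
Qed.

(** After a shift by [n] all maps of the subsequence commute with [s] almost everywhere. Invariance
    of [mu] gives convergence at the permuted point as well, and the two limits must coincide. *)
Lemma ae_limit_equivariant (ns : nat -> nat) (L : Rinf -> Rinf) :
  (forall k, (k < ns k)%N) ->
  (forall i, {ae mu, forall x, (lift_map (ns k) x i : R) @[k --> \oo] --> (L x i : R)}) ->
  forall n (s : 'S_n), {ae mu, forall x, L (perm_coord s x) = perm_coord s (L x)}.
Proof.
move=> nsk cL n s.
have {}cL : {ae mu, forall x i, (lift_map (ns k) x i : R) @[k --> \oo] --> (L x i : R)}.
  exact/ae_foralln.
have cLs := ae_perm_coord s emu cL.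
have eqv : {ae mu, forall x k, lift_map (ns (k + n)%N) (perm_coord s x) =
    perm_coord s (lift_map (ns (k + n)%N) x)}.
  apply/ae_foralln => k; apply: lift_map_equivariant.
    by rewrite (leq_trans (leq_addl k n))// ltnW.
  exact: leq_ltn_trans (nsk _).
apply: filterS3 cL cLs eqv => x cx csx ex.
apply/funext => i; rewrite perm_coordE.
have h1 := csx i; have h2 := cx (perm_nat s i).
rewrite -(cvg_shiftn n) in h1; rewrite -(cvg_shiftn n) in h2.
have {}h1 : (lift_map (ns (k + n)%N) x (perm_nat s i) : R) @[k --> \oo] -->
    (L (perm_coord s x) i : R).
  by move: h1; under eq_fun do rewrite ex perm_coordE.
exact: (cvg_unique _ h1 h2).
Qed.

(** The projection of [theta] to n coordinates is a competitor of [T_ n]. Its cost is n equal terms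
    by exchangeability of [theta], and the cost of [T_ n] is so by equivariance. *)
Lemma cost_lower_bound n (theta : probability (Rinf * Rinf)%type R) :
  (0 < n)%N -> coupling mu nu theta -> exchangeable2 theta ->
  (\int[mu]_x ((x 0%N - lift_map n x 0%N) ^+ 2)%:E <=
   \int[theta]_z ((z.1 0%N - z.2 0%N) ^+ 2)%:E)%E.
Proof.
move=> n0 [th1 th2] eth.
have m1 i : measurable_fun setT (fun z : Rinf * Rinf => z.1 i : R).
  exact: (measurable_eval_comp i measurable_fst).
have m2 i : measurable_fun setT (fun z : Rinf * Rinf => z.2 i : R).
  exact: (measurable_eval_comp i measurable_snd).
have mth i : measurable_fun setT (fun z : Rinf * Rinf => (z.1 i - z.2 i : R) ^+ 2).
  by apply: measurable_funX; exact: measurable_funB.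
have sym (i : 'I_n) : (\int[theta]_z ((z.1 i - z.2 i) ^+ 2)%:E =
    \int[theta]_z ((z.1 0%N - z.2 0%N) ^+ 2)%:E)%E.
  have [s [s0 _]] := transposition_exists (ltn_ord i).
  have mX : measurable_fun setT
      (fun z : Rinf * Rinf => (perm_coord s z.1, perm_coord s z.2)).
    apply/measurable_fun_pair; apply: (measurableT_comp (measurable_perm_coord s)).
      exact: measurable_fst.
    exact: measurable_snd.
  rewrite -(ge0_integral_eq_law mX (@measurable_id _ _ setT) (fun A mA => eth n s A mA)
    (f := fun z : Rinf * Rinf => ((z.1 0%N - z.2 0%N : R) ^+ 2)%:E)).
  - by apply: eq_integral => z _; rewrite /= !perm_coordE s0.
  - exact/measurable_EFinP.
  - by move=> z; rewrite lee_fin sqr_ge0.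
pose pq (z : Rinf * Rinf) : borel 'rV[R]_n * borel 'rV[R]_n :=
  (proj_coord n z.1, proj_coord n z.2).
have mpq : measurable_fun setT pq.
  by apply/measurable_fun_pair; apply: measurableT_comp => //.
pose pp : {mfun (Rinf * Rinf)%type >-> (borel 'rV[R]_n * borel 'rV[R]_n)%type} :=
  HB.pack pq (isMeasurableFun.Build _ _ _ _ pq mpq).
have mproj A : measurable A -> measurable (proj_coord n @^-1` A : set Rinf).
  by move=> mA; rewrite -[X in measurable X]setTI; exact: measurable_proj_coord.
have cth : coupling (distribution mu (proj_coord n)) (distribution nu (proj_coord n))
    (distribution theta pp).
  split=> A mA; first exact: (th1 _ (mproj _ mA)).
  exact: (th2 _ (mproj _ mA)).
have mc : measurable_fun setT (fun z : borel 'rV[R]_n * borel 'rV[R]_n =>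
    \sum_(i < n) (z.1 ord0 i - z.2 ord0 i) ^+ 2).
  apply: measurable_sum => i; apply: measurable_funX; apply: measurable_funB.
    exact: (measurableT_comp (measurable_coord i) measurable_fst).
  exact: (measurableT_comp (measurable_coord i) measurable_snd).
have c0 (z : borel 'rV[R]_n * borel 'rV[R]_n) :
    (0 <= (\sum_(i < n) (z.1 ord0 i - z.2 ord0 i) ^+ 2)%:E)%E.
  by rewrite lee_fin sumr_ge0// => i _; rewrite sqr_ge0.
have optn := (optT n0).2 _ cth.
rewrite !ge0_integral_distribution// in optn;
  try exact/measurable_EFinP; try (by move=> v; exact: c0);
  try by apply: measurableT_comp; [exact/measurable_EFinP|exact: measurable_graph].
have mL i : measurable_fun setT (fun x : Rinf => (x i - lift_map n x i : R) ^+ 2).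
  apply: measurable_funX; apply: measurable_funB; first exact: measurable_eval.
  by apply: measurable_eval_comp; exact: measurable_lift_map.
have eL := @integral_sum_equal _ _ _ mu n
  (fun i (x : Rinf) => (x i - lift_map n x i) ^+ 2) _
  (fun i => mL i) (fun i x => sqr_ge0 _)
  (fun i => integral_sqr_dist_coord emu (@measurable_id _ _ setT)
    (@measurable_lift_map n) (@ae_id_equivariant n)
    (fun s => lift_map_equivariant_ord s n0) (ltn_ord i)).
have eR := @integral_sum_equal _ _ _ theta n
  (fun i z => (z.1 i - z.2 i) ^+ 2) _ (fun i => mth i) (fun i z => sqr_ge0 _) sym.
have : (n%:R%:E * \int[mu]_x ((x 0%N - lift_map n x 0%N) ^+ 2)%:E <=
    n%:R%:E * \int[theta]_z ((z.1 0%N - z.2 0%N) ^+ 2)%:E)%E.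
  rewrite -eL -eR; apply: (le_trans _ (le_trans optn _));
    rewrite le_eqVlt; apply/orP; left; apply/eqP; apply: eq_integral => x _;
    congr (_%:E); apply: eq_bigr => i _ /=.
    by rewrite mxE lift_map_ord.
  by rewrite !mxE.
by rewrite lee_pmul2l// lte_fin ltr0n.
Qed.

Lemma exchangeable_monge_solution : exists T : {mfun Rinf >-> Rinf},
  exchangeable_map T /\
  exchangeable_kantorovich_solution mu nu (distribution mu (graph T)).
Proof.
have [ns [L [nsk mL cL]]] := lift_map_ae_limit.
have [T [eT TL]] := equivariant_modification mL (ae_limit_equivariant nsk cL).
have {}cL i : {ae mu, forall x, (lift_map (ns k) x i : R) @[k --> \oo] --> (T x i : R)}.
  by apply: filterS2 TL (cL i) => x ->.
have ns0 k : (0 < ns k)%N by exact: leq_ltn_trans (nsk k).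
have mlift := measurable_lift_map.
have lawT A : measurable A -> mu (T @^-1` A) = nu A.
  (* For [k >= n] the dimension [ns k] exceeds [n], so the first [n] coordinates already have their
     law under [nu]. *)
  apply: (law_of_limit (F := fun k => lift_map (ns k))) => // n.
  exists n => // k /= nk a.
  have [B mB ->] := half_cylinder_proj_coord n a.
  rewrite -(law_proj_lift_map _ (ns0 k) mB)//.
  by rewrite (leq_trans nk)// ltnW.
exists T; split=> //; split.
  split; first by split=> // A mA; exact: lawT.
  move=> n s A mA.
  have mgA : measurable (graph T @^-1` A).
    by rewrite -[X in measurable X]setTI; exact: measurable_graph.
  apply: (etrans _ (emu s mgA)); congr (mu _).
  (* Since [T] is equivariant at every point, its graph map intertwines a permutation with its
     diagonal action on pairs. *)
  apply/seteqP; split=> x /=; rewrite /graph /=;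
    by have /(congr1 (fun f => f x)) /= <- := eT n s.
move=> theta [cth eth].
have mc : measurable_fun setT (fun z : Rinf * Rinf => ((z.1 0%N - z.2 0%N : R) ^+ 2)%:E).
  apply/measurable_EFinP; apply: measurable_funX; apply: measurable_funB.
    exact: (measurable_eval_comp 0 measurable_fst).
  exact: (measurable_eval_comp 0 measurable_snd).
rewrite ge0_integral_distribution//; last by move=> z; rewrite lee_fin sqr_ge0.
(* The bound by the cost of [theta] holds for every [k], so Fatou's lemma passes it to the limit
   map. *)
apply: (@integral_ae_lim_le _ _ _ mu
  (fun k x => ((x 0%N - lift_map (ns k) x 0%N) ^+ 2)%:E)).
- move=> k; apply/measurable_EFinP; apply: measurable_funX; apply: measurable_funB.
    exact: measurable_eval.
  exact: measurable_eval_comp.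
- by move=> k x; rewrite lee_fin sqr_ge0.
- by apply: measurableT_comp mc _; exact: measurable_graph.
- apply: filterS (cL 0%N) => x cx.
  apply: cvg_EFin; first exact: nearW.
  have cd : ((x 0%N : R) - lift_map (ns k) x 0%N) @[k --> \oo] --> (x 0%N - T x 0%N : R).
    by apply: cvgB; [exact: cvg_cst|exact: cx].
  exact: (cvgM cd cd).
- by move=> k; exact: cost_lower_bound.
Qed.

End finite_dimensional_maps.

Theorem theorem3p2 (R : realType) (mu nu : probability (borel (Rinfty R)) R)
    (Phi : forall n, 'rV[R]_n -> R)
    (T_ : forall n, {mfun borel 'rV[R]_n >-> borel 'rV[R]_n}) :
  exchangeable mu -> exchangeable nu ->
  (\int[mu]_x ((x 0%N) ^+ 2)%:E + \int[nu]_y ((y 0%N) ^+ 2)%:E < +oo)%E ->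
  (forall n, (0 < n)%N ->
     [/\ convex_function [set: 'rV[R]_n] (Phi n),
         forall x, differentiable (Phi n) x,
         forall x, T_ n x = gradient (Phi n) x
       & optimal_map (distribution mu (proj_coord n))
           (distribution nu (proj_coord n)) (T_ n)]) ->
  (exists2 K : R, 0 < K & forall n, (0 < n)%N -> forall a b : 'rV[R]_n,
     Phi n a - Phi n b - dot (gradient (Phi n) b) (a - b)
       <= K * enorm (a - b) ^+ 2) ->
  exists T : {mfun borel (Rinfty R) >-> borel (Rinfty R)},
    exchangeable_map T /\
    exchangeable_kantorovich_solution mu nu (distribution mu (graph T)).
Proof.
move=> emu enu m2 hyp [K K0 PhiK].
have sq0 (lam : probability (borel (Rinfty R)) R) :
    (0 <= \int[lam]_x ((x 0%N : R) ^+ 2)%:E)%E.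
  by apply: integral_ge0 => x _; rewrite lee_fin sqr_ge0.
apply: (@exchangeable_monge_solution R mu nu emu enu _ _ Phi T_ _ _ _ _ K K0 PhiK).
- by move=> i; apply: exchangeable_Lfun2 => //; apply: le_lt_trans m2; rewrite leeDl.
- by move=> i; apply: exchangeable_Lfun2 => //; apply: le_lt_trans m2; rewrite leeDr.
- by move=> n /hyp[].
- by move=> n /hyp[].
- by move=> n /hyp[].
- by move=> n /hyp[].
Qed.
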